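(* For every fair division instance $\mathcal{I}=(N,M,\mathcal{V})$ in which all agents have additive valuations, and every real number $\alpha \le \frac{3}{4}+\frac{3}{3836}$, there exists an $\alpha$-MMS allocation of $\mathcal{I}$.
   Context: A fair division instance $\mathcal{I}=(N,M,\mathcal{V})$ consists of a set of agents $N=[n]$, a finite set $M$ of indivisible goods, and valuations $v_i:2^M\to\mathbb{R}_{\ge 0}$ for $i\in N$, which are additive: $v_i(S)=\sum_{g\in S}v_i(\{g\})$. For a valuation $v$, a set $S$ of goods and an integer $d\ge 1$, $\mathrm{MMS}^d_v(S)=\max_{(P_1,\dots,P_d)}\min_{j\in[d]}v(P_j)$, where the maximum ranges over all partitions of $S$ into $d$ (possibly empty) bundles. The maximin share of agent $i$ is $\mathrm{MMS}_i=\mathrm{MMS}^n_{v_i}(M)$. An allocation assigns to each agent $i$ a bundle $A_i\subseteq M$, the bundles being pairwise disjoint; it is $\alpha$-MMS if $v_i(A_i)\ge \alpha\cdot \mathrm{MMS}_i$ for every agent $i\in N$. *)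

(* Defs.v *)
From HB Require Import structures.
From mathcomp Require Import all_boot all_order all_algebra.
From mathcomp Require Import reals.
Set Implicit Arguments. Unset Strict Implicit. Unset Printing Implicit Defensive.
Import Order.TTheory GRing.Theory Num.Theory.
Local Open Scope ring_scope.

Definition bval (R : realType) (G : finType) (v : G -> R) (S : {set G}) : R :=
  \sum_(g in S) v g.

(* Value of the smallest bundle of the partition of S into d'.+1 bundles
   given by the assignment f : G -> 'I_d'.+1 (bundle j = S ∩ f^-1(j)). *)
Definition minbundle (R : realType) (G : finType) (v : G -> R) (S : {set G})
  (d' : nat) (f : {ffun G -> 'I_d'.+1}) : R :=
  \big[Order.min/bval v [set g in S | f g == ord0]]_(j < d'.+1)
     bval v [set g in S | f g == j].

(* MMS^d_v(S): max over all partitions of S into d (possibly empty) bundles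
   of the minimum bundle value. Only meaningful for d >= 1 (set to 0 for d=0). *)
Definition MMSd (R : realType) (G : finType) (v : G -> R) (d : nat) (S : {set G}) : R :=
  match d with
  | 0 => 0
  | d'.+1 => \big[Order.max/minbundle v S ([ffun=> ord0] : {ffun G -> 'I_d'.+1})]_(f : {ffun G -> 'I_d'.+1})
               minbundle v S f
  end.

Definition MMS (R : realType) (n : nat) (G : finType) (v : 'I_n -> G -> R) (i : 'I_n) : R :=
  MMSd (v i) n [set: G].

(* An allocation: pairwise disjoint bundles A i (not required to cover M). *)
Definition is_allocation (n : nat) (G : finType) (A : 'I_n -> {set G}) : Prop :=
  forall i j : 'I_n, i != j -> [disjoint A i & A j].

Definition is_alpha_MMS (R : realType) (n : nat) (G : finType) (v : 'I_n -> G -> R)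
  (alpha : R) (A : 'I_n -> {set G}) : Prop :=
  is_allocation A /\ forall i : 'I_n, alpha * MMS v i <= bval (v i) (A i).

(* Main.v *)
Require Import Defs.
From HB Require Import structures.
From mathcomp Require Import all_boot all_order all_algebra.
From mathcomp Require Import reals.
From mathcomp Require Import lra zify.
Set Implicit Arguments. Unset Strict Implicit. Unset Printing Implicit Defensive.
Import Order.TTheory GRing.Theory Num.Theory.
Local Open Scope ring_scope.

(* Scale every valuation [x] so that its maximin share is at least [1 + d]; a bundle is acceptable
   if it is worth [3/4 + d], and [d = 3/956] gives the ratio [3/4 + 3/3836].  By sorting, all agents
   may be assumed to rank the goods [0, 1, 2, ...] in the same order.

   Rounding [x] by [phi], which is flat just above 1/4 and just above 3/4, costs at most [d] per
   block, so every agent has a partition into [n] blocks worth 1 for [u = phi x].  The rounding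
   makes each of the bundles {0}, {n-1, n}, {2n-2, 2n-1, 2n}, {0, 2n} removable without damage to
   the partitions of the other agents, so we may assume that no agent accepts any of them.

   The rest is bag filling: [n] bags of two goods among the first [2n], completed one good at a
   time by the goods [2n, 2n+1, ...].  An agent is critical if [u (2n) >= 1/4 - d]; only critical
   agents can lose value, about [d] per bag.  Note that an agent who has priority rejects all
   bundles except those taken by other agents with priority, so a priority class that is not
   almost everyone is always served.
   - If at most [(1 - 4 d) n] agents are critical, they get priority, with the bags {k, 2n-1-k};
     the other agents lose nothing.
   - Otherwise the others get priority, with the bags {2i, 2i+1}.  A critical agent measures goods
     by a second rounding, [psix] or [psiy], flat around 1/4, 3/8 and 1/2.  A rejected pair of
     adjacent goods is then worth at most 3/4, except for the one pair that straddles 3/8, so that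
     almost nothing is lost. *)

(** * Roundings of values *)

(** Split the entries at [t]. Four entries of size at least [t] already contribute [4 * (1 / 4)].
    Otherwise there are at most three, one hypothesis for each number, and the small entries enter
    only through their sum, with [K] as a lower bound for their rounded total. *)
Lemma cap_sum (R : realFieldType) (psi K : R -> R) (t M s0 : R) :
  (forall x, 0 <= x -> 0 <= psi x) ->
  (forall x, t <= x -> x <= M -> 1 / 4 <= psi x) ->
  (forall l : seq R, all (fun x => (0 <= x) && (x < t)) l ->
     K (\sum_(x <- l) x) <= \sum_(x <- l) psi x) ->
  (forall r, 0 <= r -> s0 <= r -> 1 <= K r) ->
  (forall a r, t <= a <= M -> 0 <= r -> s0 <= a + r -> 1 <= psi a + K r) ->
  (forall a b r, t <= a <= M -> t <= b <= M -> 0 <= r ->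
     s0 <= a + b + r -> 1 <= psi a + psi b + K r) ->
  (forall a b c r, t <= a <= M -> t <= b <= M -> t <= c <= M -> 0 <= r ->
     s0 <= a + b + c + r -> 1 <= psi a + psi b + psi c + K r) ->
  forall l : seq R, all (fun x => (0 <= x) && (x <= M)) l ->
    s0 <= \sum_(x <- l) x -> 1 <= \sum_(x <- l) psi x.
Proof.
move=> p0 p4 pK H0 H1 H2 H3 l /allP lM.
rewrite (bigID (fun x => t <= x)) /= => hs.
rewrite (bigID (fun x => t <= x)) /=.
rewrite -!(big_filter _ (fun x => t <= x)) -!(big_filter _ (fun x => ~~ (t <= x))) in hs *.
set h := [seq x <- l | t <= x] in hs *; set r := [seq x <- l | ~~ (t <= x)] in hs *.
have rP : all (fun x => (0 <= x) && (x < t)) r.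
  apply/allP => x; rewrite mem_filter -ltNge => /andP[xt /lM /andP[-> _]].
  by rewrite xt.
have hP : all (fun x => t <= x <= M) h.
  by apply/allP => x; rewrite mem_filter => /andP[-> /lM /andP[_ ->]].
have r0 : 0 <= \sum_(x <- r) x.
  by rewrite big_seq; apply: sumr_ge0 => x /(allP rP) /andP[].
have h0 : all (fun x => 0 <= x) h.
  by apply/allP => x; rewrite mem_filter => /andP[_ /lM /andP[]].
have q0 : 0 <= \sum_(x <- r) psi x.
  by rewrite big_seq; apply: sumr_ge0 => x /(allP rP) /andP[/p0].
have Kr := pK _ rP.
case: h hs hP h0 => [|a [|b [|c [|e h]]]]; rewrite !(big_nil, big_cons) /=.
- by move=> hs _ _; have := H0 _ r0; lra.
- move=> hs /andP[ha _] _; have := H1 a _ ha r0; lra.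
- move=> hs /and3P[ha hb _] _; have := H2 a b _ ha hb r0; lra.
- move=> hs /and4P[ha hb hc _] _; have := H3 a b c _ ha hb hc r0; lra.
move=> _ /and5P[/andP[? ?] /andP[? ?] /andP[? ?] /andP[? ?] _] /and5P[_ _ _ _ h0].
have : 0 <= \sum_(x <- h) psi x.
  by rewrite big_seq; apply: sumr_ge0 => x /(allP h0)/p0.
have := p4 a; have := p4 b; have := p4 c; have := p4 e; lra.
Qed.

(* Throughout, [15 * (21 * d) <= 1] says [d <= 1/315]. *)
Definition phi (R : realFieldType) (d x : R) : R :=
  if x < 1 / 4 then x else if x < 1 / 4 + d / 3 then 1 / 4
  else if x < 3 / 4 then x else if x < 3 / 4 + d then 3 / 4 else 1.

Lemma phi_cases (R : realFieldType) (d x : R) : 0 < d -> 15 * (21 * d) <= 1 ->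
  [\/ x < 1 / 4 /\ phi d x = x, [/\ 1 / 4 <= x, x < 1 / 4 + d / 3 & phi d x = 1 / 4],
    [/\ 1 / 4 + d / 3 <= x, x < 3 / 4 & phi d x = x] |
    3 / 4 <= x /\ (phi d x = 3 / 4 /\ x < 3 / 4 + d \/ phi d x = 1 /\ 3 / 4 + d <= x)].
Proof.
move=> d0 d1; rewrite /phi.
case: (ltP x) => h1; first by constructor 1.
case: (ltP x) => h2; first by constructor 2.
case: (ltP x) => h3; first by constructor 3.
by constructor 4; split => //; case: (ltP x) => h4; [left | right].
Qed.

Lemma phi_mono (R : realFieldType) (d x y : R) : 0 < d -> 15 * (21 * d) <= 1 ->
  x <= y -> phi d x <= phi d y.
Proof.
move=> d0 d1 xy.
by case: (phi_cases x d0 d1) => [[? ->]|[? ? ->]|[? ? ->]|[? [[-> ?]|[-> ?]]]];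
   case: (phi_cases y d0 d1) => [[? ->]|[? ? ->]|[? ? ->]|[? [[-> ?]|[-> ?]]]]; lra.
Qed.

Lemma phi_ge0 (R : realFieldType) (d x : R) : 0 < d -> 15 * (21 * d) <= 1 ->
  0 <= x -> 0 <= phi d x.
Proof.
by move=> d0 d1 x0; case: (phi_cases x d0 d1) => [[? ->]|[? ? ->]|[? ? ->]|[? [[-> ?]|[-> ?]]]]; lra.
Qed.

(** The alternatives record the loss: at most [d / 3] near [1 / 4], none, or up to [d] with [3 / 4]
    still left. *)
Lemma phi_large (R : realFieldType) (d x : R) : 0 < d -> 15 * (21 * d) <= 1 ->
  1 / 4 <= x -> x <= 3 / 4 + d -> 1 / 4 <= phi d x /\
  [\/ x <= 1 / 4 + d / 3 /\ 1 / 4 <= phi d x, x <= phi d x | 3 / 4 <= phi d x].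
Proof.
move=> d0 d1 ? ?; case: (phi_cases x d0 d1) => [[? ->]|[? ? ->]|[? ? ->]|[? [[-> ?]|[-> ?]]]]; (split; first lra).
- by constructor 2.
- by constructor 1; split; lra.
- by constructor 2.
- by constructor 3.
- by constructor 3; lra.
Qed.

(** An entry of at least [3 / 4 + d] rounds to [1] by itself. Otherwise the slack [d] pays either
    for three losses of [d / 3] or for one loss of [d] at [3 / 4]. The two kinds never add up, since
    [3 / 4] together with another entry that rounds to at least [1 / 4] is already [1]. *)
Lemma phi_sum (R : realFieldType) (d : R) (l : seq R) : 0 < d -> 15 * (21 * d) <= 1 ->
  all (fun x => 0 <= x) l -> 1 + d <= \sum_(x <- l) x -> 1 <= \sum_(x <- l) phi d x.
Proof.
move=> d0 d1 l0.
have [lM|] := boolP (all (fun x => (0 <= x) && (x <= 3 / 4 + d)) l); last first.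
  case/allPn => y yl yM _.
  have {}yM : 3 / 4 + d <= y.
    by have := allP l0 y yl; move: yM; rewrite negb_and -!ltNge; case/orP; lra.
  rewrite (big_rem y yl) /=.
  have : 0 <= \sum_(x <- rem y l) phi d x.
    by rewrite big_seq; apply: sumr_ge0 => x /mem_rem /(allP l0) H; apply: phi_ge0.
  by case: (phi_cases y d0 d1) => [[? ->]|[? ? ->]|[? ? ->]|[? [[-> ?]|[-> ?]]]]; lra.
move: l lM {l0}; apply: (@cap_sum R (@phi R d) id (1/4)).
- by move=> x; apply: phi_ge0.
- by move=> x ? ?; case: (phi_cases x d0 d1) => [[? ->]|[? ? ->]|[? ? ->]|[? [[-> ?]|[-> ?]]]]; lra.
- move=> r /allP rP; rewrite big_seq [leRHS]big_seq; apply: ler_sum => x /rP /andP[_ ?].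
  by case: (phi_cases x d0 d1) => [[? ->]|[? ? ->]|[? ? ->]|[? [[-> ?]|[-> ?]]]]; lra.
- by move=> r ? ?; lra.
- move=> a r /andP[ha ha'] ? ?.
  by case: (phi_large d0 d1 ha ha') => ? [[? ?]|?|?]; lra.
- move=> a b r /andP[ha ha'] /andP[hb hb'] ? ?.
  case: (phi_large d0 d1 ha ha') => ? [[? ?]|?|?]; last by case: (phi_large d0 d1 hb hb'); lra.
    by case: (phi_large d0 d1 hb hb') => ? [[? ?]|?|?]; lra.
  by case: (phi_large d0 d1 hb hb') => ? [[? ?]|?|?]; lra.
- move=> a b c r /andP[ha ha'] /andP[hb hb'] /andP[hc hc'] ? ?.
  case: (phi_large d0 d1 ha ha') => ? [[? ?]|?|?]; last first.
  + by case: (phi_large d0 d1 hb hb'); case: (phi_large d0 d1 hc hc'); lra.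
  + case: (phi_large d0 d1 hb hb') => ? [[? ?]|?|?]; last by case: (phi_large d0 d1 hc hc'); lra.
    * by case: (phi_large d0 d1 hc hc') => ? [[? ?]|?|?]; lra.
    * by case: (phi_large d0 d1 hc hc') => ? [[? ?]|?|?]; lra.
  + case: (phi_large d0 d1 hb hb') => ? [[? ?]|?|?]; last by case: (phi_large d0 d1 hc hc'); lra.
    * by case: (phi_large d0 d1 hc hc') => ? [[? ?]|?|?]; lra.
    * by case: (phi_large d0 d1 hc hc') => ? [[? ?]|?|?]; lra.
Qed.

(** * Roundings for critical agents *)

Lemma sum_min_le (R : realFieldType) (k b : R) (l : seq R) : 0 <= k -> 0 <= b ->
  all (fun x => 0 <= x) l ->
  Num.min (k * \sum_(x <- l) x) b <= \sum_(x <- l) Num.min (k * x) b.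
Proof.
move=> k0 b0; elim: l => [|x l ih] /=; first by rewrite !big_nil ge_min; lra.
case/andP=> x0 l0; rewrite !big_cons; have := ih l0.
have s10 : 0 <= \sum_(x <- l) x by rewrite big_seq; apply: sumr_ge0 => y /(allP l0).
move: (\sum_(y <- l) y) s10 (\sum_(y <- l) Num.min (k * y) b) => s1 s10 s2.
have kx : 0 <= k * x by apply: mulr_ge0.
have ks : 0 <= k * s1 by apply: mulr_ge0.
rewrite mulrDr; move: (k * x) (k * s1) kx ks => A B ? ?.
case: (leP A) => ?; case: (leP B) => ?; case: (leP (A + B)) => ?; lra.
Qed.

(** On nonnegative values this rounding loses only just above [3 / 8], at most [d / 2], and above
    [1 / 2]. The gains elsewhere pay for these losses within a block worth [1]. *)
Definition psix (R : realFieldType) (d x : R) : R :=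
  if x <= 3 / 16 then x + Num.min (1 / 13 * x) (5 / 2 * d)
  else if x <= 1 / 4 then Num.min (1 / 4) (x + 2 * d)
  else if x <= 3 / 8 + d / 2 then Num.min (3 / 8) (x + d / 2)
  else Num.min (1 / 2) (x + 5 / 2 * d).

(** Compared with [psix], this rounding also loses up to [15 / 4 * d] just above [1 / 4], in
    exchange for the factor [63 / 50] on small values and the gains [5 * d] and [8 * d] on large
    ones. The flat piece at [1 / 4] begins at [25 / 126], where [63 / 50 * x] reaches [1 / 4]. *)
Definition psiy (R : realFieldType) (d x : R) : R :=
  if x <= 1 / 4 + 15 / 4 * d then Num.min (1 / 4) (63 / 50 * x)
  else if x <= 3 / 8 + d / 2 then Num.min (3 / 8) (x + 5 * d)
  else Num.min (1 / 2) (x + 8 * d).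

Lemma psix_cases (R : realFieldType) (d x : R) :
  [\/ [/\ x <= 3 / 16, 1 / 13 * x <= 5 / 2 * d & psix d x = x + 1 / 13 * x] \/
      [/\ x <= 3 / 16, 5 / 2 * d <= 1 / 13 * x & psix d x = x + 5 / 2 * d],
      [/\ 3 / 16 < x, x <= 1 / 4 - 2 * d & psix d x = x + 2 * d],
      [/\ 3 / 16 < x, 1 / 4 - 2 * d <= x, x <= 1 / 4 & psix d x = 1 / 4] |
   [\/ [/\ 1 / 4 < x, x + d / 2 <= 3 / 8 & psix d x = x + d / 2],
     [/\ 1 / 4 < x, 3 / 8 <= x + d / 2, x <= 3 / 8 + d / 2 & psix d x = 3 / 8],
     [/\ 3 / 8 + d / 2 < x, x + 5 / 2 * d <= 1 / 2 & psix d x = x + 5 / 2 * d] |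
     [/\ 3 / 8 + d / 2 < x, 1 / 2 <= x + 5 / 2 * d & psix d x = 1 / 2]]].
Proof.
rewrite /psix; case: (leP x (3 / 16)) => h1; first constructor 1.
  by case: (leP (1 / 13 * x) (5 / 2 * d)) => ?; [left | right]; split => //; lra.
case: (leP x (1 / 4)) => h2.
  by case: (leP (1 / 4) (x + 2 * d)) => ?; [constructor 3 | constructor 2]; split => //; lra.
constructor 4; case: (leP x (3 / 8 + d / 2)) => h3.
  by case: (leP (3 / 8) (x + d / 2)) => ?; [constructor 2 | constructor 1]; split => //; lra.
by case: (leP (1 / 2) (x + 5 / 2 * d)) => ?; [constructor 4 | constructor 3]; split => //; lra.
Qed.

Lemma psiy_cases (R : realFieldType) (d x : R) : 0 < d ->
  [\/ x <= 25 / 126 /\ psiy d x = 63 / 50 * x,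
      [/\ 25 / 126 <= x, x <= 1 / 4 + 15 / 4 * d & psiy d x = 1 / 4] |
   [\/ [/\ 1 / 4 + 15 / 4 * d < x, x + 5 * d <= 3 / 8 & psiy d x = x + 5 * d],
     [/\ 1 / 4 + 15 / 4 * d < x, 3 / 8 <= x + 5 * d, x <= 3 / 8 + d / 2 & psiy d x = 3 / 8],
     [/\ 3 / 8 + d / 2 < x, x + 8 * d <= 1 / 2 & psiy d x = x + 8 * d] |
     [/\ 3 / 8 + d / 2 < x, 1 / 2 <= x + 8 * d & psiy d x = 1 / 2]]].
Proof.
move=> d0; rewrite /psiy; case: (leP x (1 / 4 + 15 / 4 * d)) => h1.
  by case: (leP (1 / 4) (63 / 50 * x)) => ?; [constructor 2 | constructor 1]; split => //; lra.
constructor 3; case: (leP x (3 / 8 + d / 2)) => h3.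
  by case: (leP (3 / 8) (x + 5 * d)) => ?; [constructor 2 | constructor 1]; split => //; lra.
by case: (leP (1 / 2) (x + 8 * d)) => ?; [constructor 4 | constructor 3]; split => //; lra.
Qed.

Ltac case_psix x d := case: (psix_cases d x) =>
  [[[? ? ->]|[? ? ->]]|[? ? ->]|[? ? ? ->]|[[? ? ->]|[? ? ? ->]|[? ? ->]|[? ? ->]]].
Ltac case_psiy x d0 := case: (psiy_cases x d0) =>
  [[? ->]|[? ? ->]|[[? ? ->]|[? ? ? ->]|[? ? ->]|[? ? ->]]].

Lemma psix_ge0 (R : realFieldType) (d x : R) : 0 < d -> 0 <= x -> 0 <= psix d x.
Proof. by move=> d0 x0; case_psix x d; lra. Qed.

Lemma psiy_ge0 (R : realFieldType) (d x : R) : 0 < d -> 0 <= x -> 0 <= psiy d x.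
Proof. by move=> d0 x0; case_psiy x d0; lra. Qed.

Inductive or5 (P1 P2 P3 P4 P5 : Prop) : Prop :=
  Or51 of P1 | Or52 of P2 | Or53 of P3 | Or54 of P4 | Or55 of P5.

(** Common description of both roundings on large values, [p] being the rounded [x]: [q] is the
    tolerated loss above [1 / 4], and [b3], [b4] are the gains on the sloped pieces below and above
    [3 / 8]. *)
Definition psi_class (R : realFieldType) (d q b3 b4 x p : R) :=
  or5 (x <= 1 / 4 + q /\ 1 / 4 <= p) (x <= 3 / 8 /\ x + b3 <= p)
   (x <= 3 / 8 + d / 2 /\ 3 / 8 <= p) (3 / 8 + d / 2 <= x /\ x + b4 <= p)
   (1 / 2 <= p).

Lemma psix_large (R : realFieldType) (d x : R) : 0 < d -> 15 * (21 * d) <= 1 ->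
  1 / 4 - 2 * d <= x <= 1 / 2 + 2 * d ->
  1 / 4 <= psix d x /\ psi_class d 0 (d / 2) (5 / 2 * d) x (psix d x).
Proof.
move=> d0 d1 /andP[? ?]; case_psix x d; (split; first lra).
- by lra.
- by lra.
- by constructor 1; split; lra.
- by constructor 1; split; lra.
- by constructor 2; split; lra.
- by constructor 3; split; lra.
- by constructor 4; split; lra.
- by constructor 5.
Qed.

Lemma psiy_large (R : realFieldType) (d x : R) : 0 < d -> 15 * (21 * d) <= 1 ->
  25 / 126 <= x <= 1 / 2 + 2 * d ->
  1 / 4 <= psiy d x /\ psi_class d (15 / 4 * d) (5 * d) (8 * d) x (psiy d x).
Proof.
move=> d0 d1 /andP[? ?]; case_psiy x d0; (split; first lra).
- by constructor 1; split; lra.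
- by constructor 1; split; lra.
- by constructor 2; split; lra.
- by constructor 3; split; lra.
- by constructor 4; split; lra.
- by constructor 5.
Qed.

Ltac case_class := case=> [[? ?]|[? ?]|[? ?]|[? ?]|?].

(** The tight case has one value up to [1 / 2 + 2 * d] and one up to [3 / 8 + d / 2]: together they
    lose [5 / 2 * d], and then [r] is at least [1 / 8 - 5 / 2 * d]. So the first alternative
    excludes this case and the second one pays for it. Beyond [3 / 16] it is harmless, and [2 * d]
    covers a value near [1 / 2] next to one near [1 / 4]. *)
Lemma psix_two (R : realFieldType) (d a b pa pb r k : R) : 0 < d -> 15 * (21 * d) <= 1 ->
  1 <= a + b + r -> 0 <= r -> r <= k -> a <= 1 / 2 + 2 * d -> b <= 1 / 2 + 2 * d ->
  [\/ r < 1 / 8 - 5 / 2 * d, r + 5 / 2 * d <= k | 3 / 16 < r /\ r + 2 * d <= k] ->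
  psi_class d 0 (d / 2) (5 / 2 * d) a pa -> psi_class d 0 (d / 2) (5 / 2 * d) b pb ->
  1 <= pa + pb + k.
Proof.
move=> d0 d1 h r0 kr a1 b1.
case=> [rs|{}kr|[rs {}kr]].
- by case_class; case_class; lra.
- by case_class; case_class; lra.
- by case_class; case_class; lra.
Qed.

Lemma psix_three (R : realFieldType) (d a b c pa pb pc r k : R) : 0 < d -> 15 * (21 * d) <= 1 ->
  1 <= a + b + c + r -> 0 <= r -> r <= k -> 1 / 4 <= pa -> 1 / 4 <= pb -> 1 / 4 <= pc ->
  r < 1 / 8 - 5 / 2 * d \/ r + 2 * d <= k ->
  psi_class d 0 (d / 2) (5 / 2 * d) a pa -> psi_class d 0 (d / 2) (5 / 2 * d) b pb ->
  psi_class d 0 (d / 2) (5 / 2 * d) c pc -> 1 <= pa + pb + pc + k.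
Proof.
move=> d0 d1 h r0 kr a4 b4 c4; case=> [rs|{}kr].
  case_class; (try by move=> *; lra); (case_class; (try by move=> *; lra));
  by case_class; lra.
have ab x p : psi_class d 0 (d / 2) (5 / 2 * d) x p -> x - d / 2 <= p \/ 1 / 2 <= p.
  move=> {h a4 b4 c4 kr r0}.
  by case_class; [left|left|left|left|right]; lra.
move=> /ab ha /ab hb /ab hc {ab}; move: ha hb hc.
by case=> ?; case=> ?; case=> ?; lra.
Qed.

Lemma psiy_two (R : realFieldType) (d a b pa pb r : R) : 0 < d -> 15 * (21 * d) <= 1 ->
  1 <= a + b + r -> 0 <= r -> a <= 1 / 2 + 2 * d -> b <= 1 / 2 + 2 * d ->
  psi_class d (15 / 4 * d) (5 * d) (8 * d) a pa ->
  psi_class d (15 / 4 * d) (5 * d) (8 * d) b pb -> 1 <= pa + pb + 63 / 50 * r.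
Proof. by move=> d0 d1 h r0 a1 b1; case_class; case_class; lra. Qed.

Lemma psiy_three (R : realFieldType) (d a b c pa pb pc r : R) : 0 < d -> 15 * (21 * d) <= 1 ->
  1 <= a + b + c + r -> 0 <= r -> 1 / 4 <= pa -> 1 / 4 <= pb -> 1 / 4 <= pc ->
  psi_class d (15 / 4 * d) (5 * d) (8 * d) a pa ->
  psi_class d (15 / 4 * d) (5 * d) (8 * d) b pb ->
  psi_class d (15 / 4 * d) (5 * d) (8 * d) c pc -> 1 <= pa + pb + pc + 63 / 50 * r.
Proof.
move=> d0 d1 h r0 a4 b4 c4.
case_class; (try by move=> *; lra); (case_class; (try by move=> *; lra));
by case_class; lra.
Qed.

Lemma psix_sum (R : realFieldType) (d : R) (l : seq R) : 0 < d -> 15 * (21 * d) <= 1 ->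
  all (fun x => (0 <= x) && (x <= 1 / 2 + 2 * d)) l ->
  1 <= \sum_(x <- l) x -> 1 <= \sum_(x <- l) psix d x.
Proof.
(* [K r] bounds from below the rounded total of small entries with sum [r]. The slope [1 / 13]
   yields the full gain [5 / 2 * d] from [1 / 8 - 5 / 2 * d] on, because [35 * d <= 1 / 8]. *)
move=> d0 d1; set K := fun r => r + Num.min (1 / 13 * r) (if r <= 3/16 then 5 / 2 * d else 2 * d).
have K2 r : 0 <= r -> r <= K r.
  by move=> ?; rewrite /K; case: (leP r (3 / 16)) => ?; case: (leP (1 / 13 * r)); lra.
have K3 r : 1 / 8 - 5 / 2 * d <= r -> r <= 3 / 16 -> r + 5 / 2 * d <= K r.
  by move=> ? h; rewrite /K h; case: (leP (1 / 13 * r)); lra.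
have K4 r : 1 / 8 <= r -> r + 2 * d <= K r.
  by move=> ?; rewrite /K; case: (leP r (3 / 16)) => ?; case: (leP (1 / 13 * r)); lra.
have K1 (r : seq R) : all (fun x => (0 <= x) && (x < 1 / 4 - 2 * d)) r ->
    K (\sum_(x <- r) x) <= \sum_(x <- r) psix d x.
  move=> rP.
  have r0 : all (fun x => 0 <= x) r by apply: sub_all rP => x /andP[].
  set s := \sum_(x <- r) x.
  have ex x : x \in r -> x <= s.
    move=> xr; rewrite /s (big_rem x xr) /= lerDl big_seq; apply: sumr_ge0 => y /mem_rem.
    exact: (allP r0).
  rewrite /K; case: (leP s) => s3.
    (* If the sum is at most [3 / 16], so is every entry, and only the first piece of [psix] occurs.
       Otherwise entries may lie on the piece [x + 2 * d] as well, hence the smaller cap of the gain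
       in the second case. *)
    apply: (@le_trans _ _ (\sum_(x <- r) (x + Num.min (1 / 13 * x) (5 / 2 * d)))).
      by rewrite big_split /= -/s lerD2l; apply: sum_min_le => //; lra.
    rewrite big_seq [leRHS]big_seq; apply: ler_sum => x /ex; rewrite /psix; case: (leP x (3/16)) => //; lra.
  apply: (@le_trans _ _ (\sum_(x <- r) (x + Num.min (1 / 13 * x) (2 * d)))).
    by rewrite big_split /= -/s lerD2l; apply: sum_min_le => //; lra.
  rewrite big_seq [leRHS]big_seq; apply: ler_sum => x /(allP rP) /andP[? ?].
  by case: (leP (1 / 13 * x) (2 * d)) => ?; case_psix x d; lra.
move: K K1 K2 K3 K4 => K K1 K2 K3 K4.
have K5 r : [\/ r < 1 / 8 - 5 / 2 * d, r + 5 / 2 * d <= K r | 3 / 16 < r /\ r + 2 * d <= K r].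
  have [?|?] := ltP r (1 / 8 - 5 / 2 * d); first by constructor 1.
  have [?|?] := leP r (3 / 16); first by constructor 2; apply: K3.
  by constructor 3; split => //; apply: K4; lra.
have L x h := @psix_large R d x d0 d1 h.
apply: (@cap_sum R (@psix R d) K (1/4 - 2 * d)) => {l}.
- by move=> x; apply: psix_ge0.
- by move=> x h1 h2; case: (L x) => //; rewrite h1.
- exact: K1.
- by move=> r r0 h; apply: le_trans h (K2 _ r0).
- move=> a r ha r0 h; move: (L a ha) (K2 _ r0) (K5 r); move: (K r) (psix d a) => k pa.
  case=> a4 ca kr; case/andP: ha => {L K K1 K2 K3 K4 K5} _ ha; move: ca.
  by case_class; case=> [?|?|[? ?]]; lra.
- move=> a b r ha hb r0 h; apply: (psix_two d0 d1 h r0 (K2 _ r0) _ _ (K5 r)).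
  + by case/andP: ha.
  + by case/andP: hb.
  + by case: (L a ha).
  + by case: (L b hb).
- move=> a b c r ha hb hc r0 h; case: (L a ha) (L b hb) (L c hc) => a4 ca [b4 cb] [c4 cc].
  apply: (psix_three d0 d1 h r0 (K2 _ r0) a4 b4 c4 _ ca cb cc).
  by case: (K5 r) => [?|?|[]]; [left|right; lra|right].
Qed.

Lemma psiy_sum (R : realFieldType) (d : R) (l : seq R) : 0 < d -> 15 * (21 * d) <= 1 ->
  all (fun x => (0 <= x) && (x <= 1 / 2 + 2 * d)) l ->
  1 <= \sum_(x <- l) x -> 1 <= \sum_(x <- l) psiy d x.
Proof.
move=> d0 d1; have L x h := @psiy_large R d x d0 d1 h.
apply: (@cap_sum R (@psiy R d) (fun r => 63/50 * r) (25/126)) => {l}.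
- by move=> x; apply: psiy_ge0.
- by move=> x h1 h2; case: (L x) => //; rewrite h1.
- move=> r rP; rewrite mulr_sumr big_seq [leRHS]big_seq; apply: ler_sum => x /(allP rP) /andP[? ?].
  by case_psiy x d0; lra.
- by move=> r ? ?; lra.
- move=> a r ha r0 h; move: (L a ha); move: (psiy d a) => pa [a4 ca]; case/andP: ha => {L} _ ha; move: ca.
  by case_class; lra.
- move=> a b r ha hb r0 h; apply: (psiy_two d0 d1 h r0).
  + by case/andP: ha.
  + by case/andP: hb.
  + by case: (L a ha).
  + by case: (L b hb).
- move=> a b c r ha hb hc r0 h; case: (L a ha) (L b hb) (L c hc) => a4 ca [b4 cb] [c4 cc].
  exact: (psiy_three d0 d1 h r0 a4 b4 c4 ca cb cc).
Qed.

(** * Bag filling *)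

Definition bagv (R : realFieldType) (w : nat -> R) (b : nat * nat) : R := w b.1 + w b.2.

Definition bag_goods (L : seq (nat * nat)) : seq nat :=
  flatten [seq [:: b.1; b.2] | b <- L].

Lemma sum_bag_goods (R : realFieldType) (w : nat -> R) (L : seq (nat * nat)) :
  \sum_(g <- bag_goods L) w g = \sum_(b <- L) bagv w b.
Proof.
elim: L => [|b L ih]; first by rewrite !big_nil.
by rewrite /bag_goods /= !big_cons -/(bag_goods L) ih addrA.
Qed.

Lemma perm_bag_goods_rem (L : seq (nat * nat)) (b : nat * nat) : b \in L ->
  perm_eq (bag_goods L) ([:: b.1; b.2] ++ bag_goods (rem b L)).
Proof.
move=> bL; rewrite -[_ ++ _]/(bag_goods (b :: rem b L)) /bag_goods.
by apply: perm_flatten; apply: perm_map; apply: perm_to_rem.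
Qed.

Lemma sum_pick (R : realFieldType) (T : finType) (i r : T) (x : nat -> R)
    (o : nat -> T) (s t : seq nat) : uniq (t ++ s) ->
  \sum_(g <- t ++ s | (if g \in t then r else o g) == i) x g =
  (if r == i then \sum_(g <- t) x g else 0) + \sum_(g <- s | o g == i) x g.
Proof.
rewrite cat_uniq => /and3P[_ /hasPn ts _]; rewrite big_cat /=; congr (_ + _).
  rewrite big_seq_cond; case: ifP => ri.
    rewrite [RHS]big_seq; apply: eq_bigl => g.
    by case: (g \in t) => //=; rewrite ri.
  by apply: big_pred0 => g; case: (g \in t); rewrite //= ri.
rewrite big_seq_cond [RHS]big_seq_cond; apply: eq_bigl => g.
by case: (boolP (g \in s)) => //= /ts /= /negPf ->.
Qed.

(* [I j N L p] is an invariant of an agent [j] among the remaining agents [N],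
   when the bags [L] and the goods [p, p+1, ..., m-1] are still available. *)
Lemma bag_filling (R : realFieldType) (T : finType) (x : T -> nat -> R) (A : R)
    (m : nat) (Pr : {set T}) (I : T -> {set T} -> seq (nat * nat) -> nat -> Prop) :
  T -> (forall i k, 0 <= x i k) ->
  (forall (N : {set T}) (L : seq (nat * nat)) (p : nat) (j r : T) (b : nat * nat), j \in N -> r \in N -> j != r -> b \in L -> I j N L p ->
     (j \in Pr -> r \notin Pr -> bagv (x j) b < A) -> I j (N :\ r) (rem b L) p) ->
  (forall (N : {set T}) (b : nat * nat) (L : seq (nat * nat)) (p q : nat) (j r : T), j \in N -> r \in N -> j != r -> (p < q <= m)%N -> I j N (b :: L) p ->
     (forall b', b' \in b :: L -> bagv (x j) b' < A) ->
     bagv (x j) b + \sum_(p <= k < q.-1) x j k < A ->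
     (j \in Pr -> r \notin Pr -> bagv (x j) b + \sum_(p <= k < q) x j k < A) ->
     I j (N :\ r) L q) ->
  (forall (N : {set T}) (b : nat * nat) (L : seq (nat * nat)) (p : nat) (j : T), j \in N -> I j N (b :: L) p -> #|N| = (size L).+1 ->
     (forall b', b' \in b :: L -> bagv (x j) b' < A) ->
     A <= bagv (x j) b + \sum_(p <= k < m) x j k) ->
  forall (N : {set T}) (L : seq (nat * nat)) (p : nat), #|N| = size L -> uniq (bag_goods L ++ index_iota p m) ->
    (forall j, j \in N -> I j N L p) ->
  exists o : nat -> T, forall i, i \in N ->
    A <= \sum_(g <- bag_goods L ++ index_iota p m | o g == i) x i g.
Proof.
move=> t0 x0 H1 H2 H3 N L p cL; have [n sL] : exists n, size L = n by exists (size L).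
rewrite sL in cL; elim: n N L p cL sL => [|n ih] N L p cN sL us IN.
  have N0 : N = set0 by apply/eqP; rewrite -cards_eq0 cN.
  by exists (fun _ => t0) => i; rewrite N0 inE.
(* Among the agents satisfying [P], one with priority is chosen whenever there is one; so if the
   chosen agent has no priority, every priority agent fails [P]. *)
have prio_choice (P : pred T) : (exists2 r, r \in N & P r) ->
    exists r, [/\ r \in N, P r & forall j, j \in N -> j \in Pr -> r \notin Pr -> ~~ P j].
  case=> r rN Pr0; case: (pickP (fun j => [&& j \in N, j \in Pr & P j])) => [j|none].
    by case/and3P=> jN jP Pj; exists j; split => // k _ _; rewrite jP.
  by exists r; split => // j jN jP _; have := none j; rewrite jN jP /= => ->.
(* Common induction step: [r] leaves with the goods [t], and the owner function obtained for the
   smaller instance is overridden on [t]. *)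
have step r t s' L' p' : r \in N -> perm_eq (bag_goods L ++ index_iota p m) (t ++ s') ->
    s' = bag_goods L' ++ index_iota p' m -> size L' = n ->
    A <= \sum_(g <- t) x r g ->
    (forall j, j \in N -> j != r -> I j (N :\ r) L' p') ->
    exists o : nat -> T, forall i, i \in N ->
    A <= \sum_(g <- bag_goods L ++ index_iota p m | o g == i) x i g.
  move=> rN pe sE sL' rA IN'.
  have us' := us; rewrite (perm_uniq pe) in us'.
  have [||||o oP] := ih (N :\ r) L' p'.
  - by have := cardsD1 r N; rewrite rN cN; lia.
  - exact: sL'.
  - by rewrite -sE; move: us'; rewrite cat_uniq => /and3P[].
  - by move=> j /setD1P[jr jN]; apply: IN'.
  exists (fun g => if g \in t then r else o g) => i iN.
  rewrite (perm_big _ pe) /= (sum_pick _ _ _ _ us').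
  case: (eqVneq r i) => [ri|ri].
    by rewrite -ri; apply: (le_trans rA); rewrite lerDl; apply: sumr_ge0.
  by rewrite add0r sE; apply: oP; rewrite !inE eq_sym ri.
case: (boolP [exists r in N, has (fun b => A <= bagv (x r) b) L]) => [/existsP[r0 /andP[r0N r0b]]|none].
  have [|r [rN /hasP[b bL rb] prio]] := prio_choice (fun r => has (fun b => A <= bagv (x r) b) L).
    by exists r0.
  apply: (step r [:: b.1; b.2] (bag_goods (rem b L) ++ index_iota p m) (rem b L) p) => //.
  - by rewrite catA perm_cat2r perm_bag_goods_rem.
  - by rewrite size_rem // sL.
  - by rewrite !big_cons big_nil addr0.
  move=> j jN jr; apply: H1 => //; first exact: IN.
  by move=> jP rP; have /hasPn/(_ b bL) := prio j jN jP rP; rewrite -ltNge.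
have noacc j b : j \in N -> b \in L -> bagv (x j) b < A.
  move=> jN bL; rewrite ltNge; apply: contra none => h.
  by apply/existsP; exists j; rewrite jN; apply/hasP; exists b.
case: L sL cN us IN step noacc {none} => [//|b L] /= [sL] cN us IN step noacc.
have /card_gt0P[j0 j0N] : (0 < #|N|)%N by rewrite cN.
pose acc q r := A <= bagv (x r) b + \sum_(p <= k < q) x r k.
have pm : (p <= m)%N.
  rewrite leqNgt; apply/negP => mp; have := H3 N b L p j0 j0N (IN j0 j0N).
  rewrite cN sL => /(_ erefl (fun b' => noacc j0 b' j0N)).
  by rewrite big_geq ?(ltnW mp) // addr0 leNgt noacc // mem_head.
(* No bag is accepted as it stands, so the first one is filled. The least [q] that some agent
   accepts is taken; by minimality everyone rejects the bag without its last good [q.-1]. *)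
have exq : exists q, (p <= q)%N && [exists r in N, acc q r].
  exists m; rewrite pm; apply/existsP; exists j0; rewrite j0N.
  by apply: (H3 N) => //; [exact: IN | rewrite cN sL | move=> b'; apply: noacc].
case: (ex_minnP exq) => q /andP[pq /existsP[r0 /andP[r0N r0q]]] qmin.
have qm : (q <= m)%N.
  apply: qmin; rewrite pm; apply/existsP; exists j0; rewrite j0N.
  by apply: (H3 N) => //; [exact: IN | rewrite cN sL | move=> b'; apply: noacc].
have {}pq : (p < q)%N.
  rewrite ltn_neqAle pq andbT; apply: contraTneq r0q => <-.
  by rewrite /acc big_geq // addr0 -ltNge noacc // mem_head.
have noacc' j : j \in N -> bagv (x j) b + \sum_(p <= k < q.-1) x j k < A.
  move=> jN; rewrite ltNge; apply/negP => h.
  have : (q <= q.-1)%N; last by lia.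
  by apply: qmin; rewrite -ltnS prednK ?pq; [apply/existsP; exists j; rewrite jN | lia].
have [|r [rN racc prio]] := prio_choice (acc q); first by exists r0.
have pe : perm_eq (([:: b.1; b.2] ++ bag_goods L) ++ index_iota p m)
    (([:: b.1; b.2] ++ index_iota p q) ++ (bag_goods L ++ index_iota q m)).
  rewrite -!catA perm_cat2l.
  have -> : index_iota p m = index_iota p q ++ index_iota q m.
    by rewrite /index_iota -{2}(subnKC (ltnW pq)) -iotaD; congr iota; lia.
  by rewrite perm_catCA.
apply: (step r ([:: b.1; b.2] ++ index_iota p q) (bag_goods L ++ index_iota q m) L q) => //.
- by rewrite big_cat /= !big_cons big_nil addr0; move: racc; rewrite /acc /bagv.
move=> j jN jr; apply: (H2 N b L p q j r jN rN jr _ (IN j jN)).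
- by apply/andP.
- by move=> b'; apply: noacc.
- exact: noacc'.
by move=> jP rP; rewrite ltNge; apply: prio.
Qed.

(** * Critical agents *)

Lemma psix_half (R : realFieldType) (d x : R) : 0 < d -> 15 * (21 * d) <= 1 -> psix d x <= 1 / 2.
Proof. by move=> d0 d1; case_psix x d; lra. Qed.

Lemma psiy_half (R : realFieldType) (d x : R) : 0 < d -> 15 * (21 * d) <= 1 -> psiy d x <= 1 / 2.
Proof. by move=> d0 d1; case_psiy x d0; lra. Qed.

Lemma psix_quarter (R : realFieldType) (d x : R) : 0 < d -> 15 * (21 * d) <= 1 ->
  x <= 1 / 4 -> psix d x <= 1 / 4.
Proof. by move=> d0 d1 ?; case_psix x d; lra. Qed.

Lemma psiy_quarter (R : realFieldType) (d x : R) : 0 < d -> 15 * (21 * d) <= 1 ->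
  x <= 1 / 4 + 15 / 4 * d -> psiy d x <= 1 / 4.
Proof. by move=> d0 d1 ?; case_psiy x d0; lra. Qed.

Lemma psix_le (R : realFieldType) (d x : R) : 0 < d -> 15 * (21 * d) <= 1 -> 0 <= x ->
  psix d x <= 14 / 13 * x.
Proof. by move=> d0 d1 ?; case_psix x d; lra. Qed.

Lemma psiy_le (R : realFieldType) (d x : R) : 0 < d -> 15 * (21 * d) <= 1 -> 0 <= x ->
  psiy d x <= 63 / 50 * x.
Proof. by move=> d0 d1 ?; case_psiy x d0; lra. Qed.

(** Indicator of a pair that straddles the end of the flat piece at [3 / 8], valued in [R] so that
    its sum over the bags can enter the potentials. *)
Definition crossing (R : realFieldType) (d : R) (u : nat -> R) (b : nat * nat) : R :=
  if (3 / 8 + d / 2 < u b.1) && (u b.2 <= 3 / 8 + d / 2) then 1 else 0.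

Lemma crossing_ge0 (R : realFieldType) (d : R) u b : 0 <= crossing d u b.
Proof. by rewrite /crossing; case: ifP. Qed.

(** If both goods are at most [3 / 8 + d / 2], each rounds to at most [3 / 8]. Otherwise the bound
    on the sum forces the pair to cross, and the gains [5 / 2 * d] and [d / 2] on top of [3 / 4 + d]
    give the term [4 * d]. For [psiy] the gains [8 * d] and [5 * d] give [14 * d] in the same
    way. *)
Lemma psix_pair (R : realFieldType) (d : R) (u : nat -> R) b : 0 < d -> 15 * (21 * d) <= 1 ->
  u b.2 <= u b.1 -> bagv u b < 3 / 4 + d ->
  bagv (psix d \o u) b <= 3 / 4 + 4 * d * crossing d u b.
Proof.
rewrite /bagv /crossing /=; move: (u b.1) (u b.2) => x y d0 d1 yx xy.
have [x1|x1] := ltP (3 / 8 + d / 2) x; last first.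
  by have : psix d x <= 3 / 8 /\ psix d y <= 3 / 8; last (rewrite /= mulr0; lra);
     split; [case_psix x d | case_psix y d]; lra.
have -> : y <= 3 / 8 + d / 2 by lra.
have hx : psix d x <= 1 / 2 /\ psix d x <= x + 5 / 2 * d by case_psix x d; lra.
have [y4|y4] : psix d y <= 1 / 4 \/ psix d y <= y + d / 2 by case_psix y d; [left|left|left|left|right|right|left|left]; lra.
  by rewrite /= mulr1; lra.
by rewrite /= mulr1; lra.
Qed.

Lemma psiy_pair (R : realFieldType) (d : R) (u : nat -> R) b : 0 < d -> 15 * (21 * d) <= 1 ->
  u b.2 <= u b.1 -> bagv u b < 3 / 4 + d ->
  bagv (psiy d \o u) b <= 3 / 4 + 14 * d * crossing d u b.
Proof.
rewrite /bagv /crossing /=; move: (u b.1) (u b.2) => x y d0 d1 yx xy.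
have [x1|x1] := ltP (3 / 8 + d / 2) x; last first.
  by have : psiy d x <= 3 / 8 /\ psiy d y <= 3 / 8; last (rewrite /= mulr0; lra);
     split; [case_psiy x d0 | case_psiy y d0]; lra.
have -> : y <= 3 / 8 + d / 2 by lra.
have hx : psiy d x <= 1 / 2 /\ psiy d x <= x + 8 * d by case_psiy x d0; lra.
have [y4|y4] : psiy d y <= 1 / 4 \/ psiy d y <= y + 5 * d by case_psiy y d0; [left|left|right|right|left|left]; lra.
  by rewrite /= mulr1; lra.
by rewrite /= mulr1; lra.
Qed.

(** The constant [13 / 2] originates here. In the tight case [1 / 4 < x <= 3 / 8] and [3 / 16 < l]:
    the four values total less than [3 / 4 + d + (1 / 4 - 13 / 2 * d)], and the gains are at most
    [d / 2], [d], [2 * d] and [2 * d], which gives [1]. *)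
Lemma psix_quad (R : realFieldType) (d x y g l : R) : 0 < d -> 15 * (21 * d) <= 1 ->
  1 / 4 - d <= y -> y <= x -> l <= g -> 0 <= l -> g <= 1 / 4 - 13 / 2 * d -> x + y + g < 3 / 4 + d ->
  psix d x + psix d y + psix d g + psix d l <= 1.
Proof.
move=> d0 d1 y4 yx lg l0 g4 s.
have [x4|x4] := leP x (1 / 4).
  have := @psix_quarter R d x d0 d1 x4; have := @psix_quarter R d y d0 d1; have := @psix_quarter R d g d0 d1.
  have := @psix_quarter R d l d0 d1; lra.
have hx : psix d x <= x + 5 / 2 * d /\ (x <= 3 / 8 -> psix d x <= x + d / 2) by case_psix x d; lra.
have hy : psix d y <= y + d by case_psix y d; lra.
have hg : psix d g <= g + 5 / 2 * d /\ (3 / 16 < g -> psix d g <= g + 2 * d) by case_psix g d; lra.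
have hl : psix d l <= l + 5 / 2 * d /\ (3 / 16 < l -> psix d l <= l + 2 * d) by case_psix l d; lra.
have [l3|l3] := ltP (3 / 16) l; last by lra.
have [x8|x8] := leP x (3 / 8); last by lra.
have := hx.2 x8; have := hl.2 l3; have g3 : 3 / 16 < g by lra.
have := hg.2 g3; lra.
Qed.

Definition antitone (R : realFieldType) (u : nat -> R) :=
  forall i j, (i <= j)%N -> u j <= u i.

Lemma sum_fill_le (R : realFieldType) (u psi : nat -> R) (c : R) p q :
  (forall k, psi k <= c * u k) ->
  \sum_(p <= k < q) psi k <= c * \sum_(p <= k < q) u k.
Proof. by move=> h; rewrite mulr_sumr; apply: ler_sum. Qed.

(** Before the last fill there are at least two others, each worth no less, so the last one adds at
    most half of their total. *)
Lemma three_fills (R : realFieldType) (u : nat -> R) p q :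
  antitone u -> (forall k, 0 <= u k) -> (p.+2 < q)%N ->
  2 * \sum_(p <= k < q) u k <= 3 * \sum_(p <= k < q.-1) u k.
Proof.
move=> ua u0 pq; case: q pq => // q pq /=.
rewrite big_nat_recr /=; last by lia.
rewrite big_ltn; last by lia.
rewrite big_ltn; last by lia.
have : 0 <= \sum_(p.+2 <= k < q) u k by apply: sumr_ge0.
have := ua p q; have := ua p.+1 q => h1 h2.
have {}h1 : u q <= u p.+1 by apply: h1; lia.
have {}h2 : u q <= u p by apply: h2; lia.
lra.
Qed.

Lemma fill_count (p q : nat) : (p < q)%N -> [\/ q = p.+1, q = p.+2 | (p.+2 < q)%N].
Proof.
move=> pq; have [->|h1] := eqVneq q p.+1; first by constructor 1.
by have [->|h2] := eqVneq q p.+2; [constructor 2 | constructor 3; lia].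
Qed.

(** A single fill adds at most [1 / 4] to [psix_pair], and two fills are [psix_quad]. With three or
    more, the value before rounding is at most [7 / 8 + 5 / 2 * d] by [three_fills], so even the
    crude factor [14 / 13] is affordable. *)
Lemma psix_fill (R : realFieldType) (d : R) (u : nat -> R) b p q :
  0 < d -> 15 * (21 * d) <= 1 -> antitone u -> (forall k, 0 <= u k) ->
  1 / 4 - d <= u b.2 -> u b.2 <= u b.1 -> u p <= 1 / 4 -> (p < q)%N ->
  bagv u b < 3 / 4 + d -> bagv u b + \sum_(p <= k < q.-1) u k < 3 / 4 + d ->
  q = p.+1 \/ u p <= 1 / 4 - 13 / 2 * d ->
  bagv (psix d \o u) b + \sum_(p <= k < q) psix d (u k) <= 1 + 4 * d * crossing d u b.
Proof.
move=> d0 d1 ua u0 b4 b21 p4 pq hb hS ev.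
have cr0 : 0 <= d * crossing d u b by rewrite mulr_ge0 ?crossing_ge0 ?ltW.
have P1 := psix_pair d0 d1 b21 hb.
have F1 := psix_quarter d0 d1 p4.
case: (fill_count pq) => [qE|qE|q3].
- by rewrite qE big_nat1; lra.
- case: ev => [qE'|ev]; first by have := ltnn q; rewrite {1}qE' qE ltnSn.
  move: hS; rewrite qE /= big_nat1 big_nat_recr //= big_nat1 => hS.
  have := @psix_quad R d (u b.1) (u b.2) (u p) (u p.+1) d0 d1 b4 b21.
  by rewrite /bagv /= in hS *; move=> /(_ (ua _ _ (leqnSn p)) (u0 _) ev hS); lra.
- have T := three_fills ua u0 q3.
  have E1 := sum_fill_le p q (fun k => psix_le d0 d1 (u0 k)).
  have B1 := psix_le d0 d1 (u0 b.1); have B2 := psix_le d0 d1 (u0 b.2).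
  by rewrite /bagv /= in hS *; lra.
Qed.

Lemma psiy_fill (R : realFieldType) (d : R) (u : nat -> R) (s : R) p q :
  0 < d -> 15 * (21 * d) <= 1 -> antitone u -> (forall k, 0 <= u k) ->
  u p <= 1 / 4 -> (p < q)%N ->
  1 / 2 - 2 * d <= s -> s + \sum_(p <= k < q.-1) u k < 3 / 4 + d ->
  \sum_(p <= k < q) psiy d (u k) <= 1 / 2.
Proof.
move=> d0 d1 ua u0 p4 pq hs hS.
have F k : (p <= k)%N -> psiy d (u k) <= 1 / 4.
  by move=> pk; apply: psiy_quarter => //; have := ua _ _ pk; lra.
case: (fill_count pq) => [->|->|q3].
- by rewrite big_nat1; have := F p (leqnn p); lra.
- by rewrite big_nat_recr //= big_nat1; have := F p (leqnn p); have := F p.+1 (leqnSn p); lra.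
- have T := three_fills ua u0 q3.
  have E1 := sum_fill_le p q (fun k => psiy_le d0 d1 (u0 k)).
  lra.
Qed.

Definition pot (R : realFieldType) (m : nat) (w : nat -> R) (L : seq (nat * nat)) (p : nat) : R :=
  \sum_(b <- L) bagv w b + \sum_(p <= k < m) w k.

Lemma pot_cons (R : realFieldType) m (w : nat -> R) b L p q : (p <= q <= m)%N ->
  pot m w (b :: L) p = bagv w b + \sum_(p <= k < q) w k + pot m w L q.
Proof.
by case/andP=> pq qm; rewrite /pot big_cons (big_cat_nat pq qm) /= addrACA.
Qed.

Lemma pot_rem (R : realFieldType) m (w : nat -> R) b L p : b \in L ->
  pot m w L p = bagv w b + pot m w (rem b L) p.
Proof. by move=> bL; rewrite /pot (big_rem b bL) /= addrA. Qed.

(** The pairwise order lets a bound on the second good of a bag carry over to the goods of all later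
    bags. *)
Definition pairs_ok (n : nat) (L : seq (nat * nat)) :=
  all (fun b => (b.1 < b.2 < 2 * n)%N) L && pairwise (fun b c => (b.2 < c.1)%N) L.

Lemma pairs_ok_rem n L b : pairs_ok n L -> pairs_ok n (rem b L).
Proof.
case/andP=> h1 h2; rewrite /pairs_ok (subseq_pairwise (rem_subseq b L) h2) andbT.
by apply/allP => c /mem_rem /(allP h1).
Qed.

(* Before the first bag that needs two fills both potentials are maintained; the value of
   the first fill at that moment decides which one survives. *)
Definition invB (R : realFieldType) (d : R) (n m : nat) (u : nat -> R)
    (L : seq (nat * nat)) (p : nat) : Prop :=
  [/\ (2 * n <= p)%N, pairs_ok n L &
  [\/ (size L)%:R - 4 * d + 4 * d * \sum_(b <- L) crossing d u b <= pot m (psix d \o u) L p /\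
      (size L)%:R - 14 * d + 14 * d * \sum_(b <- L) crossing d u b <= pot m (psiy d \o u) L p,
      (size L)%:R - 4 * d + 4 * d * \sum_(b <- L) crossing d u b <= pot m (psix d \o u) L p /\
      u p <= 1 / 4 - 13 / 2 * d |
      (size L)%:R - 55 / 2 * d <= pot m (psiy d \o u) L p /\
      (forall b, b \in L -> u b.1 <= 1 / 4 + 15 / 4 * d)]].

(** Both roundings are at most [1 / 2], so a taken pair costs at most [1], and the required
    potential drops by at least as much. *)
Lemma invB_take (R : realFieldType) (d : R) n m (u : nat -> R) L p b :
  0 < d -> 15 * (21 * d) <= 1 -> b \in L -> invB d n m u L p -> invB d n m u (rem b L) p.
Proof.
move=> d0 d1 bL [np pL st]; split=> //; first exact: pairs_ok_rem.
have sz : (size L)%:R = 1 + (size (rem b L))%:R :> R.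
  by rewrite (perm_size (perm_to_rem bL)) /= -[LHS]/((1 + size (rem b L))%:R) natrD.
have cr : \sum_(c <- L) crossing d u c = crossing d u b + \sum_(c <- rem b L) crossing d u c.
  by rewrite (big_rem b bL).
have cr0 : 0 <= d * crossing d u b by rewrite mulr_ge0 ?crossing_ge0 ?ltW.
have hx : bagv (psix d \o u) b <= 1.
  by have := psix_half (u b.1) d0 d1; have := psix_half (u b.2) d0 d1; rewrite /bagv /=; lra.
have hy : bagv (psiy d \o u) b <= 1.
  by have := psiy_half (u b.1) d0 d1; have := psiy_half (u b.2) d0 d1; rewrite /bagv /=; lra.
move: st; rewrite sz cr !(pot_rem m _ p bL) mulrDr mulrDr.
case=> [[h1 h2]|[h1 h2]|[h1 h2]].
- by constructor 1; split; lra.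
- by constructor 2; split => //; lra.
- by constructor 3; split; [lra | move=> c /mem_rem; exact: h2].
Qed.

(** While one fill suffices, a bag costs at most [1] plus the charge for its crossing under both
    roundings. At the first bag with more fills the first fill decides: if it is at most
    [1 / 4 - 13 / 2 * d], the [psix] potential survives for good, later fills being no larger;
    otherwise the goods of the remaining bags are close to [1 / 4] and [psiy] takes over. *)
Lemma invB_fill (R : realFieldType) (d : R) n m (u : nat -> R) b L p q :
  0 < d -> 15 * (21 * d) <= 1 -> antitone u -> (forall k, 0 <= u k) ->
  1 / 4 - d <= u (2 * n)%N -> u (2 * n)%N <= 1 / 4 -> (p < q <= m)%N ->
  invB d n m u (b :: L) p -> bagv u b < 3 / 4 + d ->
  bagv u b + \sum_(p <= k < q.-1) u k < 3 / 4 + d -> invB d n m u L q.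
Proof.
move=> d0 d1 ua u0 n4 n4' /andP[pq qm] [np pL st] hb hS.
have /andP[/= /andP[/andP[b12 b2n] aL] /andP[bL pwL]] := pL.
have b4 : 1 / 4 - d <= u b.2 by apply: (le_trans n4); apply: ua; apply: ltnW.
have b21 : u b.2 <= u b.1 by apply: ua; apply: ltnW.
have p4 : u p <= 1 / 4 by apply: le_trans n4'; apply: ua.
have uqp : u q <= u p by apply: ua; apply: ltnW.
split; first exact: leq_trans np (ltnW pq).
  by rewrite /pairs_ok aL.
have pqm : (p <= q <= m)%N by rewrite ltnW.
move: st; rewrite !(pot_cons _ _ _ pqm) !big_cons /= -natr1 !mulrDr.
have P2 := psiy_pair d0 d1 b21 hb.
have Fx := psix_fill d0 d1 ua u0 b4 b21 p4 pq hb hS.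
have b12s : 1 / 2 - 2 * d <= bagv u b by rewrite /bagv; lra.
have Fy := psiy_fill d0 d1 ua u0 p4 pq b12s hS.
have p4y : psiy d (u p) <= 1 / 4 by apply: psiy_quarter => //; lra.
case=> [[h1 h2]|[h1 h2]|[h1 h2]].
- have [qE|qE] := eqVneq q p.+1.
    have {}Fx := Fx (or_introl qE).
    by constructor 1; split; [lra | move: h2; rewrite {1}qE big_nat1 /=; lra].
  have ev : bagv u b + u p < 3 / 4 + d.
    move: hS; rewrite big_ltn; last by rewrite -subn1 ltn_subRL add1n ltn_neqAle eq_sym qE.
    have : 0 <= \sum_(p.+1 <= k < q.-1) u k by apply: sumr_ge0.
    lra.
  have [g4|g4] := leP (u p) (1 / 4 - 13 / 2 * d).
    have {}Fx := Fx (or_intror g4).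
    by constructor 2; split; lra.
  (* Here [u p] exceeds [1 / 4 - 13 / 2 * d] while the bag with this fill is rejected, so the bag is
     worth less than [1 / 2 + 15 / 2 * d]. Its smaller good is thus at most [1 / 4 + 15 / 4 * d],
     which bounds all later bags, and its larger one at most [1 / 4 + 17 / 2 * d]. The bag costs at
     most [1 + 27 / 2 * d], whence the allowance [14 * d + 27 / 2 * d = 55 / 2 * d]. *)
  constructor 3; split.
    have cr0 : 0 <= d * (\sum_(c <- L) crossing d u c).
      by apply: mulr_ge0; [exact: ltW | apply: sumr_ge0 => c _; exact: crossing_ge0].
    have cr1 : 0 <= d * crossing d u b by rewrite mulr_ge0 ?crossing_ge0 ?ltW.
    have y2 : psiy d (u b.2) <= 1 / 4 by apply: psiy_quarter => //; rewrite /bagv in ev; lra.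
    have y1 : psiy d (u b.1) <= 1 / 4 + 27 / 2 * d.
      have x1 : u b.1 <= 1 / 4 + 17 / 2 * d by rewrite /bagv in ev; lra.
      by clear -d0 d1 x1; case_psiy (u b.1) d0; lra.
    by move: h2; rewrite /bagv /=; lra.
  move=> c cL; have := allP bL c cL => /= bc; have := ua _ _ (ltnW bc).
  by rewrite /bagv in ev; lra.
- have {}Fx := Fx (or_intror h2).
  by constructor 2; split; lra.
- constructor 3; split; last by move=> c cL; apply: h2; rewrite in_cons cL orbT.
  have hb1 := h2 b (mem_head _ _).
  have y1 : psiy d (u b.1) <= 1 / 4 by apply: psiy_quarter.
  have y2 : psiy d (u b.2) <= 1 / 4 by apply: psiy_quarter => //; lra.
  by move: h1; rewrite /bagv /=; lra.
Qed.

(** Otherwise the potential would be too small. Under [psix] a rejected bundle rounds to at most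
    [14 / 13 * (3 / 4 + d) <= 41 / 50]. In the [psiy] state each bag rounds to at most [1 / 2], and
    the goods outside the bags to at most [63 / 50 * (1 / 4 + 3 * d)]. *)
Lemma invB_progress (R : realFieldType) (d : R) n m (u : nat -> R) b L p :
  0 < d -> 15 * (21 * d) <= 1 -> antitone u -> (forall k, 0 <= u k) ->
  1 / 4 - d <= u (2 * n)%N -> u (2 * n)%N <= 1 / 4 ->
  invB d n m u (b :: L) p -> (forall c, c \in b :: L -> bagv u c < 3 / 4 + d) ->
  3 / 4 + d <= bagv u b + \sum_(p <= k < m) u k.
Proof.
move=> d0 d1 ua u0 n4 n4' [np pL st] hb; rewrite leNgt; apply/negP => hS.
have /andP[/= /andP[/andP[b12 b2n] aL] /andP[bL pwL]] := pL.
have cr0 : 0 <= d * (\sum_(c <- b :: L) crossing d u c).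
  by apply: mulr_ge0; [exact: ltW | apply: sumr_ge0 => c _; exact: crossing_ge0].
move: (\sum_(c <- b :: L) crossing d u c) cr0 st => cs cr0 st.
have x14 : 14 / 13 * (3 / 4 + d) <= 41 / 50 by lra.
have sL : 0 <= (size L)%:R :> R by apply: ler0n.
have bx c : bagv (psix d \o u) c <= 14 / 13 * bagv u c.
  by have := psix_le d0 d1 (u0 c.1); have := psix_le d0 d1 (u0 c.2); rewrite /bagv /=; lra.
have X : ~ (size (b :: L))%:R - 4 * d + 4 * d * cs <= pot m (psix d \o u) (b :: L) p.
  have F := sum_fill_le p m (fun k => psix_le d0 d1 (u0 k)).
  have S : \sum_(c <- L) bagv (psix d \o u) c <= \sum_(c <- L) (41 / 50).
    rewrite big_seq [leRHS]big_seq; apply: ler_sum => c cL.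
    have cbL : c \in b :: L by rewrite in_cons cL orbT.
    by have := bx c; have := hb c cbL; lra.
  move: S; rewrite big_const_seq count_predT iter_addr_0 -[_ *+ _]mulr_natr => S.
  have := bx b; rewrite /pot big_cons /= -natr1 -mulrA; clear -F S cr0 sL hS x14 d0 d1.
  by move: F; rewrite /=; lra.
case: st => [[h1 _]|[h1 _]|[h1 h2]]; [exact: X|exact: X|].
have hb1 := h2 b (mem_head _ _).
have b4 : 1 / 4 - d <= u b.2 by apply: (le_trans n4); apply: ua; apply: ltnW.
have b21 : u b.2 <= u b.1 by apply: ua; apply: ltnW.
have y1 : psiy d (u b.1) <= 1 / 4 by apply: psiy_quarter.
have y2 : psiy d (u b.2) <= 1 / 4 by apply: psiy_quarter => //; lra.
have F := sum_fill_le p m (fun k => psiy_le d0 d1 (u0 k)).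
have S : \sum_(c <- L) bagv (psiy d \o u) c <= \sum_(c <- L) (1 / 2).
  rewrite big_seq [leRHS]big_seq; apply: ler_sum => c cL.
  have /= /andP[c12 _] := allP aL c cL.
  have c1 : u c.1 <= 1 / 4 + 15 / 4 * d by apply: h2; rewrite in_cons cL orbT.
  have c2 : u c.2 <= u c.1 by apply: ua; apply: ltnW.
  have := psiy_quarter d0 d1 c1; have := psiy_quarter d0 d1 (le_trans c2 c1).
  by rewrite /bagv /=; lra.
move: S; rewrite big_const_seq count_predT iter_addr_0 -[_ *+ _]mulr_natr => S.
move: h1; rewrite /pot big_cons /= -natr1.
by move: F S sL hS; rewrite /bagv /=; lra.
Qed.

(** * Non-critical agents *)

Lemma sum_blocks (V : nmodType) (n m : nat) (f : nat -> nat) (w : nat -> V) :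
  (forall g, (g < m)%N -> (f g < n)%N) ->
  \sum_(g < m) w g = \sum_(j < n) \sum_(g < m | f g == j) w g.
Proof.
move=> fn; rewrite (exchange_big_dep xpredT) //=; apply: eq_bigr => g _.
by rewrite (big_pred1 (Ordinal (fn g (ltn_ord g)))) // => j; rewrite eq_sym.
Qed.

Lemma sum_fold (V : zmodType) (w : nat -> V) (n : nat) :
  \sum_(0 <= g < 2 * n) w g = \sum_(0 <= k < n) (w k + w (2 * n - k.+1)%N).
Proof.
have n2 : (n <= 2 * n)%N by rewrite leq_pmull.
rewrite (big_cat_nat (leq0n n) n2) /= big_split /=; congr (_ + _).
rewrite -{1}[n]add0n big_addn (_ : 2 * n - n = n)%N; last by rewrite mul2n -addnn addnK.
rewrite big_nat_rev /= big_nat [RHS]big_nat; apply: eq_bigr => k /andP[_ kn].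
by congr w; lia.
Qed.

Lemma block_pair (R : realFieldType) (m j : nat) (f : nat -> nat) (w : nat -> R) (t g : nat) :
  (forall k, 0 <= w k) -> \sum_(k < m | f k == j) w k <= 1 -> (t < m)%N -> (g < m)%N ->
  f t = j -> f g = j -> t <> g -> w t + w g <= 1.
Proof.
move=> w0 s1 tm gm ft fg tg; apply: le_trans s1.
rewrite (bigD1 (Ordinal tm)) /=; last by rewrite ft.
rewrite (bigD1 (Ordinal gm)) /=; last first.
  by rewrite fg eqxx /=; apply/eqP => -[] /esym.
by rewrite addrA lerDl; apply: sumr_ge0.
Qed.

(* Goods [0..K] exclude, in their block, every other good of index at most [2n-1-K]; counting
   the goods up to that index then leaves some block with three of value at least [w (2n-1-K)]. *)
Lemma third_bound (R : realFieldType) (n m K : nat) (f : nat -> nat) (w : nat -> R) :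
  antitone w -> (forall k, 0 <= w k) -> (forall g, (g < m)%N -> (f g < n)%N) ->
  (forall j, (j < n)%N -> \sum_(g < m | f g == j) w g = 1) -> (2 * n < m)%N -> (K < n)%N ->
  1 < w K + w (2 * n - K.+1)%N -> w (2 * n - K.+1)%N <= 1 / 3.
Proof.
move=> wa w0 fn s1 nm Kn big; rewrite leNgt; apply/negP => a3.
(* The total weight is [2 * K.+1 + (2 * n - K - K.+1) = 2 * n + 1], one more than [n] blocks can
   hold at [2] each. *)
pose c (g : nat) : nat := if (g <= K)%N then 2 else if (g < 2 * n - K)%N then 1 else 0.
have excl t g j : (j < n)%N -> (t <= K)%N -> (t < m)%N -> (g < m)%N -> f t = j -> f g = j -> t <> g -> (2 * n - K <= g)%N.
  move=> jn tK tm gm ft fg tg; rewrite leqNgt; apply/negP => gK.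
  have s := s1 j jn; have : w t + w g <= 1 by apply: (block_pair w0 _ tm gm ft fg tg); rewrite s.
  have := wa _ _ tK; have gK' : (g <= 2 * n - K.+1)%N by clear -gK; lia.
  by have := wa _ _ gK'; lra.
have blk j : (j < n)%N -> (\sum_(g < m | f g == j) c g <= 2)%N.
  move=> jn; case: (pickP (fun g : 'I_m => (f g == j) && (g <= K)%N)) => [t /andP[/eqP ft tK]|none].
    rewrite (bigD1 t) /=; last by rewrite ft.
    rewrite {1}/c tK big1 // => g /andP[/eqP fg gt].
    have gK : (2 * n - K <= g)%N.
      by apply: (@excl t g j) => //; apply/eqP; rewrite eq_sym.
    rewrite /c leqNgt (leq_trans _ gK); last by clear -Kn; lia.
    by rewrite ltnNge gK.
  have le3 : (\sum_(g < m | f g == j) c g)%N%:R * w (2 * n - K.+1)%N <= 1.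
    rewrite natr_sum mulr_suml -[leRHS](s1 j jn); apply: ler_sum => g fg.
    have := none g; rewrite fg /= /c => ->; case: ifP => gK; last by rewrite mul0r.
    by rewrite mul1r; apply: wa; clear -gK; lia.
  rewrite leqNgt; apply/negP => c3.
  have : (3 : R) <= (\sum_(g < m | f g == j) c g)%N%:R by rewrite ler_nat.
  by move: le3 a3; move: (_%:R) (w _) => x y ? ? ?; nra.
have tot : (\sum_(g < m) c g <= 2 * n)%N.
  rewrite (sum_blocks _ fn); apply: (@leq_trans (\sum_(j < n) 2)%N).
    by apply: leq_sum => j _; apply: blk.
  by rewrite sum_nat_const card_ord mulnC.
move: tot; rewrite -(big_mkord xpredT c).
have m1 : (K.+1 <= 2 * n - K)%N by lia.
have m2 : (2 * n - K <= m)%N by lia.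
rewrite (big_cat_nat (leq0n (2 * n - K)) m2) /= (big_cat_nat (leq0n K.+1) m1) /=.
have -> : (\sum_(0 <= i < K.+1) c i = 2 * K.+1)%N.
  rewrite (eq_big_nat _ _ (F2 := fun=> 2)).
    by rewrite sum_nat_const_nat subn0 mulnC.
  by move=> i /andP[_ iK]; rewrite /c -ltnS iK.
have -> : (\sum_(K.+1 <= i < 2 * n - K) c i = 2 * n - K - K.+1)%N.
  rewrite (eq_big_nat _ _ (F2 := fun=> 1%N)).
    by rewrite sum_nat_const_nat muln1.
  by move=> i /andP[iK iK']; rewrite /c leqNgt iK iK'.
lia.
Qed.

(** [beta] is the price of a filled bag: it covers a rejected bundle plus a last good worth at most
    [w (2 * n)]. If no outer pair exceeds [1], then [beta = 1] works. Otherwise let [K] be the last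
    pair that does. The weights [om] are such that a pair costs at most [2 / 3] plus the weights of
    its two goods, while each block weighs at most [1 / 3]; the sum is then at most [n]. *)
Lemma cost_bound (R : realFieldType) (d : R) (n m : nat) (f : nat -> nat) (w : nat -> R) :
  0 < d -> 15 * (21 * d) <= 1 ->
  antitone w -> (forall k, 0 <= w k) -> (forall g, (g < m)%N -> (f g < n)%N) ->
  (forall j, (j < n)%N -> \sum_(g < m | f g == j) w g = 1) -> (2 * n < m)%N ->
  w 0%N <= 3 / 4 -> w (2 * n)%N <= 1 / 4 - d -> w 0%N + w (2 * n)%N <= 3 / 4 + d ->
  exists beta, [/\ 3 / 4 + d + w (2 * n)%N <= beta, 3 / 4 + d <= beta &
    \sum_(0 <= k < n) Num.max (w k + w (2 * n - k.+1)%N) beta <= n%:R].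
Proof.
move=> d0 d1 wa w0 fn s1 nm w034 w2n4 w02.
have w2n0 := w0 (2 * n)%N.
case: (boolP [exists k : 'I_n, 1 < w k + w (2 * n - k.+1)%N]) => [/existsP[k0 k0P]|none]; last first.
  exists 1; split; [lra | lra |].
  rewrite big_mkord; apply: le_trans (_ : \sum_(i < n) 1 <= _).
    apply: ler_sum => k _; rewrite ge_max lexx andbT leNgt.
    by apply: contra none => h; apply/existsP; exists k.
  by rewrite sumr_const card_ord.
have [K KP Kmax] : exists2 K : 'I_n, 1 < w K + w (2 * n - K.+1)%N &
    forall k : 'I_n, (K < k)%N -> w k + w (2 * n - k.+1)%N <= 1.
  case: (@arg_maxnP _ k0 (fun k : 'I_n => 1 < w k + w (2 * n - k.+1)%N) (fun k : 'I_n => k : nat) k0P) => K KP Km.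
  exists K => // k Kk; rewrite leNgt; apply/negP => h.
  by have : (k <= K)%N := Km k h; rewrite leqNgt Kk.
have Kn := ltn_ord K.
have a3 := third_bound wa w0 fn s1 nm Kn KP.
set a := w (2 * n - K.+1)%N in KP a3.
have wK0 : w K <= w 0%N by apply: wa.
pose om (g : nat) : R := if (g <= K)%N then w g - 5 / 12 else
  if (g < 2 * n - K.+1)%N then w g / 3 else
  if (g < 2 * n)%N then Num.max (w g - 1 / 4) 0 else 0.
(* Since [a] exceeds [1 - w K], it exceeds [1 / 4 - d + w (2 * n)], which gives the lower bounds on
   [beta]. *)
exists (1 / 2 + 2 * d + a); split; [lra | lra |].
have excl t g j : (j < n)%N -> (t <= K)%N -> (t < m)%N -> (g < m)%N -> f t = j -> f g = j -> t <> g -> (2 * n - K <= g)%N.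
  move=> jn tK tm gm ft fg tg; rewrite leqNgt; apply/negP => gK.
  have s := s1 j jn; have : w t + w g <= 1 by apply: (block_pair w0 _ tm gm ft fg tg); rewrite s.
  have := wa _ _ tK; have gK' : (g <= 2 * n - K.+1)%N by clear -gK; lia.
  by have := wa _ _ gK'; rewrite -/a; lra.
have omw (g : nat) : (K < g)%N -> om g <= w g / 3.
  move=> Kg; rewrite /om leqNgt Kg /=; have := w0 g.
  case: ifP => // gK; case: ifP => g2n; last lra.
  have gK' : (2 * n - K.+1 <= g)%N by rewrite leqNgt gK.
  have := wa _ _ gK'; rewrite -/a => ? ?.
  by rewrite ge_max; apply/andP; split; lra.
(* A block without a good among [0..K] weighs at most a third of its value. In a block with such a
   good [t], every other good has index at least [2 * n - K]. If one of them exceeds [1 / 4],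
   subtracting [5 / 12] and [1 / 4] from the value [1] leaves [1 / 3]; otherwise only
   [w t - 5 / 12 <= 3 / 4 - 5 / 12] counts. *)
have blk j : (j < n)%N -> \sum_(g < m | f g == j) om g <= 1 / 3.
  move=> jn; case: (pickP (fun g : 'I_m => (f g == j) && (g <= K)%N)) => [t /andP[/eqP ft tK]|none]; last first.
    have -> : 1 / 3 = (\sum_(g < m | f g == j) w g) / 3 by rewrite s1.
    rewrite mulr_suml; apply: ler_sum => g fg.
    by apply: omw; have := none g; rewrite fg /= => /negbT; rewrite -ltnNge.
  have omt : om t = w t - 5 / 12 by rewrite /om tK.
  have wt : w t <= 3 / 4 by apply: le_trans w034; apply: wa.
  have st := s1 j jn; rewrite (bigD1 t) /= in st; last by rewrite ft.
  rewrite (bigD1 t) /=; last by rewrite ft.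
  rewrite omt.
  have big g : (f g == j) -> g != t :> nat -> (g < m)%N -> (2 * n - K <= g)%N.
    by move=> /eqP fg gt gm; apply: (@excl t g j) => //; apply/eqP; rewrite eq_sym.
  have omg (g : nat) : (f g == j) -> g != t :> nat -> (g < m)%N ->
      om g = (if (g < 2 * n)%N then Num.max (w g - 1 / 4) 0 else 0).
    move=> fg gt gm; have gK := big g fg gt gm.
    by rewrite /om ifF; [rewrite ifF //|]; apply/negbTE; clear -gK Kn; lia.
  case: (pickP (fun g : 'I_m => [&& f g == j, g != t & 1 / 4 < w g])) => [h /and3P[fh ht wh]|small].
    rewrite (bigD1 h) /= in st; last by rewrite fh.
    rewrite (bigD1 h) /=; last by rewrite fh.
    have oh : om h <= w h - 1 / 4.
      by rewrite omg //; case: ifP => _; rewrite ?ge_max; lra.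
    have : \sum_(i < m | (f i == j) && (i != t) && (i != h)) om i <=
           \sum_(i < m | (f i == j) && (i != t) && (i != h)) w i.
      apply: ler_sum => g /andP[/andP[fg gt] _]; rewrite omg //.
      by have := w0 g; case: ifP => _; rewrite ?ge_max; lra.
    by move: st; lra.
  have : \sum_(i < m | (f i == j) && (i != t)) om i <= 0.
    apply: sumr_le0 => g /andP[fg gt]; rewrite omg //.
    have := small g; rewrite fg gt /= => /negbT; rewrite -leNgt => ?.
    by case: ifP => _; rewrite ?ge_max; lra.
  by lra.
have tot : \sum_(0 <= g < 2 * n) om g <= n%:R / 3.
  have -> : \sum_(0 <= g < 2 * n) om g = \sum_(g < m) om g.
    rewrite -(big_mkord xpredT om) (big_cat_nat (leq0n (2 * n)) (ltnW nm)) /=.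
    have -> : \sum_(2 * n <= g < m) om g = 0; last by rewrite addr0.
    rewrite big_nat; apply: big1 => g /andP[g2n gm].
    by rewrite /om !ifF //; apply/negbTE; clear -g2n Kn; lia.
  rewrite (sum_blocks _ fn); apply: le_trans (_ : \sum_(j < n) (1 / 3) <= _).
    by apply: ler_sum => j _; apply: blk.
  by rewrite sumr_const card_ord -[_ *+ n]mulr_natr; lra.
(* The bound on [beta] uses [a <= 1 / 3], and for [k <= K] also [1 - a < w K <= w k]. *)
have costk k : (k < n)%N -> Num.max (w k + w (2 * n - k.+1)%N) (1 / 2 + 2 * d + a) <=
    2 / 3 + (om k + om (2 * n - k.+1)%N).
  move=> kn; rewrite ge_max.
  have [kK|Kk] := leqP k K.
    have o1 : om k = w k - 5 / 12 by rewrite /om kK.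
    have o2 : om (2 * n - k.+1)%N = Num.max (w (2 * n - k.+1)%N - 1 / 4) 0.
      rewrite /om ifF; last by apply/negbTE; clear -kK Kn; lia.
      by rewrite ifF ?ifT //; [clear -kK Kn; lia | apply/negbTE; clear -kK Kn; lia].
    have := wa _ _ kK.
    have : w (2 * n - k.+1)%N - 1 / 4 <= om (2 * n - k.+1)%N by rewrite o2 le_max lexx.
    have : 0 <= om (2 * n - k.+1)%N by rewrite o2 le_max lexx orbT.
    by rewrite o1 => ? ? ?; apply/andP; split; lra.
  have o1 : om k = w k / 3.
    by rewrite /om leqNgt Kk /= ifT //; clear -Kk kn; lia.
  have o2 : om (2 * n - k.+1)%N = w (2 * n - k.+1)%N / 3.
    by rewrite /om ifF ?ifT //; [clear -Kk kn; lia | apply/negbTE; clear -Kk kn; lia].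
  have := Kmax (Ordinal kn) Kk => /=.
  have k1 : (k <= 2 * n - K.+1)%N by clear -Kk kn; lia.
  have k2 : (2 * n - k.+1 <= 2 * n - K.+1)%N by clear -Kk kn; lia.
  have := wa _ _ k1; have := wa _ _ k2; rewrite -/a o1 o2 => ? ? ?.
  by apply/andP; split; lra.
apply: le_trans (_ : \sum_(0 <= k < n) (2 / 3 + (om k + om (2 * n - k.+1)%N)) <= _).
  by rewrite big_nat [leRHS]big_nat; apply: ler_sum => k /andP[_ /costk].
rewrite big_split /= -sum_fold sumr_const_nat subn0 -[_ *+ n]mulr_natr.
by move: tot; lra.
Qed.

Lemma sort_nth_le (R : realFieldType) (T : eqType) (t0 : T) (w : T -> R) (s : seq T) i j :
  (i <= j)%N -> (j < size s)%N ->
  w (nth t0 (sort (fun a b => w b <= w a) s) j) <= w (nth t0 (sort (fun a b => w b <= w a) s) i).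
Proof.
move=> ij js; set r := fun a b => w b <= w a.
have rt : total r by move=> a b; exact: le_total.
have rtr : transitive r by move=> b a c ab bc; exact: le_trans bc ab.
apply: (sorted_leq_nth rtr (fun a => lexx (w a)) t0 (sort_sorted rt s)) => //.
  by rewrite inE size_sort; exact: leq_ltn_trans ij js.
by rewrite inE size_sort.
Qed.

(** Divide every good by the value of its block and sort again. No good gains, and neither does any
    position: if the value at position [k] exceeded [u k], the [k + 1] goods at positions [0..k]
    would all have index below [k]. *)
Lemma normalized_order (R : realFieldType) (n m : nat) (u : nat -> R) (f : nat -> nat) :
  antitone u -> (forall k, 0 <= u k) -> (forall g, (g < m)%N -> (f g < n)%N) ->
  (forall j, (j < n)%N -> 1 <= \sum_(g < m | f g == j) u g) ->
  exists w f', [/\ antitone w, forall k, 0 <= w k <= u k,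
    forall g, (g < m)%N -> (f' g < n)%N &
    forall j, (j < n)%N -> \sum_(g < m | f' g == j) w g = 1].
Proof.
move=> ua u0 fn s1.
pose S j := \sum_(g < m | f g == j) u g; pose v g := u g / S (f g).
have v0 g : (g < m)%N -> 0 <= v g <= u g.
  move=> gm; have s := s1 _ (fn g gm); have s0 : 0 < S (f g) by apply: lt_le_trans s.
  apply/andP; split; first by apply: divr_ge0 => //; apply: ltW.
  by rewrite /v ler_pdivrMr // ler_peMr.
pose pi := sort (fun a b => v b <= v a) (iota 0 m).
have szpi : size pi = m by rewrite size_sort size_iota.
have pP : perm_eq pi (iota 0 m) by rewrite perm_sort.
have piP i j : (i <= j)%N -> (j < size pi)%N -> v (nth 0%N pi j) <= v (nth 0%N pi i).
  by rewrite szpi => ij jm; apply: sort_nth_le; rewrite ?size_iota.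
have pim k : (k < m)%N -> (nth 0%N pi k < m)%N.
  move=> km; have : nth 0%N pi k \in pi by rewrite mem_nth ?szpi.
  by rewrite (perm_mem pP) mem_iota.
exists (fun k => if (k < m)%N then v (nth 0%N pi k) else 0), (fun k => f (nth 0%N pi k)); split.
- move=> i j ij; case: ifP => jm.
    by rewrite (leq_ltn_trans ij jm); apply: piP => //; rewrite szpi.
  by case: ifP => // im; case/andP: (v0 _ (pim _ im)).
- move=> k; case: ifP => km; last by rewrite lexx u0.
  case/andP: (v0 _ (pim _ km)) => -> _ /=; rewrite leNgt; apply/negP => uk.
  have sub : {subset take k.+1 pi <= iota 0 k}.
    move=> g /(nthP 0%N)[i]; rewrite size_take szpi.
    have -> : (if (k.+1 < m)%N then k.+1 else m) = k.+1 by case: ltnP => // h; apply/eqP; rewrite eqn_leq h.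
    move=> ik <-; rewrite nth_take // mem_iota /= add0n ltnNge; apply/negP => ki.
    have im : (i < m)%N by apply: leq_trans ik km.
    have := piP i k ik; rewrite szpi => /(_ km) vi.
    have /andP[_ vu] := v0 _ (pim _ im).
    by have := ua _ _ ki; rewrite leNgt (lt_le_trans uk) // (le_trans vi).
  have := uniq_leq_size _ sub; rewrite take_uniq; last by rewrite (perm_uniq pP) iota_uniq.
  by move=> /(_ isT); rewrite size_takel ?szpi // size_iota ltnn.
- by move=> g gm; apply: fn; apply: pim.
move=> j jn.
transitivity (\sum_(g <- pi | f g == j) v g).
  rewrite (big_nth 0%N) szpi big_mkord; apply: eq_bigr => g _.
  by rewrite ltn_ord.
have -> : \sum_(g <- pi | f g == j) v g = \sum_(0 <= g < m | f g == j) v g.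
  by rewrite (perm_big _ pP) /= /index_iota subn0.
rewrite big_mkord.
transitivity (\sum_(g < m | f g == j) u g / S j).
  by apply: eq_bigr => g /eqP fg; rewrite /v fg.
rewrite -mulr_suml -/(S j) divff // gt_eqF //.
by apply: lt_le_trans (s1 j jn).
Qed.

(** Each remaining bag is charged a maximum: its first term pays for a bag taken as it is, and
    [beta] for a filled one, which was rejected before its last good. *)
Definition invC (R : realFieldType) (A : R) (n m : nat) (x : nat -> R)
    (L : seq (nat * nat)) (p : nat) : Prop :=
  exists w beta, [/\ antitone w, forall k, w k <= x k, A + w (2 * n)%N <= beta, A <= beta &
    (2 * n <= p)%N /\ \sum_(b <- L) Num.max (bagv w b) beta <= pot m w L p].

Lemma bagv_le (R : realFieldType) (w x : nat -> R) b : (forall k, w k <= x k) -> bagv w b <= bagv x b.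
Proof. by move=> h; rewrite /bagv lerD. Qed.

Lemma invC_take (R : realFieldType) (A : R) n m x L p b :
  b \in L -> invC A n m x L p -> invC A n m x (rem b L) p.
Proof.
move=> bL [w [beta [wa wx w2n Ab [np h]]]]; exists w, beta; split => //; split => //.
move: h; rewrite (pot_rem m _ p bL) (big_rem b bL) /=.
have : bagv w b <= Num.max (bagv w b) beta by rewrite le_max lexx.
by lra.
Qed.

Lemma invC_fill (R : realFieldType) (A : R) n m x b L p q :
  (p < q <= m)%N -> invC A n m x (b :: L) p ->
  bagv x b + \sum_(p <= k < q.-1) x k < A -> invC A n m x L q.
Proof.
move=> /andP[pq qm] [w [beta [wa wx w2n Ab [np h]]]] hS; exists w, beta; split => //.
split; first exact: leq_trans np (ltnW pq).
have pqm : (p <= q <= m)%N by rewrite ltnW.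
move: h; rewrite (pot_cons _ _ _ pqm) big_cons.
have : beta <= Num.max (bagv w b) beta by rewrite le_max lexx orbT.
have := bagv_le b wx.
have : \sum_(p <= k < q.-1) w k <= \sum_(p <= k < q.-1) x k by apply: ler_sum.
have q1 : q = q.-1.+1 by rewrite prednK //; apply: leq_ltn_trans pq.
have pq1 : (p <= q.-1)%N by rewrite -ltnS -q1.
have : \sum_(p <= k < q) w k = \sum_(p <= k < q.-1) w k + w q.-1 by rewrite {1}q1 big_nat_recr.
have : w q.-1 <= w (2 * n)%N by apply: wa; apply: leq_trans np pq1.
lra.
Qed.

Lemma invC_progress (R : realFieldType) (A : R) n m x b L p :
  invC A n m x (b :: L) p -> A <= bagv x b + \sum_(p <= k < m) x k.
Proof.
move=> [w [beta [wa wx w2n Ab [np h]]]]; rewrite leNgt; apply/negP => hS.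
move: h; rewrite /pot !big_cons.
have : beta <= Num.max (bagv w b) beta by rewrite le_max lexx orbT.
have := bagv_le b wx.
have : \sum_(p <= k < m) w k <= \sum_(p <= k < m) x k by apply: ler_sum.
have : \sum_(c <- L) bagv w c <= \sum_(c <- L) Num.max (bagv w c) beta.
  by apply: ler_sum => c _; rewrite le_max lexx.
lra.
Qed.

(** * The invariant of agents with priority *)

(** To an agent with priority, a bundle taken by another priority agent is worth at most [M], and
    one taken by anybody else less than [A]. The potential covers the other priority agents at [M],
    those without priority at [A], and a last [A] for the agent itself; hence the shift by one. *)
Definition invP (R : realFieldType) (T : finType) (Pr : {set T}) (A M : R) (n m : nat)
    (u : nat -> R) (N : {set T}) (L : seq (nat * nat)) (p : nat) : Prop :=
  [/\ (2 * n <= p)%N, forall b, b \in L -> bagv u b <= M &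
    (#|N :&: Pr|%:R - 1) * M + ((size L)%:R - #|N :&: Pr|%:R + 1) * A <= pot m u L p].

Lemma card_priority (R : realFieldType) (T : finType) (Pr N : {set T}) (r : T) : r \in N ->
  #|N :&: Pr|%:R = (r \in Pr)%:R + #|(N :\ r) :&: Pr|%:R :> R.
Proof.
by move=> rN; rewrite (cardsD1 r) inE rN /= natrD; congr (_ + #|pred_of_set _|%:R); rewrite setIDAC.
Qed.

Lemma invP_take (R : realFieldType) (T : finType) (Pr : {set T}) (A M : R) n m
    (u x : nat -> R) (N : {set T}) L p b (r : T) :
  (forall k, u k <= x k) -> r \in N -> b \in L -> invP Pr A M n m u N L p ->
  (r \notin Pr -> bagv x b < A) -> invP Pr A M n m u (N :\ r) (rem b L) p.
Proof.
move=> ux rN bL [np LM h] prio; split => //; first by move=> c /mem_rem; apply: LM.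
have sz : (size L)%:R = 1 + (size (rem b L))%:R :> R.
  by rewrite (perm_size (perm_to_rem bL)) /= -[LHS]/((1 + size (rem b L))%:R) natrD.
move: h; rewrite (card_priority R _ rN) sz (pot_rem m _ p bL).
have bM := LM b bL; have := bagv_le b ux.
case: (r \in Pr) prio => [_|/(_ isT)]; rewrite /=; lra.
Qed.

Lemma invP_fill (R : realFieldType) (T : finType) (Pr : {set T}) (A M : R) n m
    (u x : nat -> R) (N : {set T}) b L p q (r : T) :
  antitone u -> (forall k, u k <= x k) -> u (2 * n)%N <= 1 / 4 -> A + 1 / 4 <= M ->
  r \in N -> (p < q <= m)%N -> invP Pr A M n m u N (b :: L) p ->
  bagv x b + \sum_(p <= k < q.-1) x k < A ->
  (r \notin Pr -> bagv x b + \sum_(p <= k < q) x k < A) -> invP Pr A M n m u (N :\ r) L q.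
Proof.
move=> ua ux u4 AM rN /andP[pq qm] [np LM h] hS prio.
have pqm : (p <= q <= m)%N by rewrite ltnW.
split; first exact: leq_trans np (ltnW pq).
  by move=> c cL; apply: LM; rewrite in_cons cL orbT.
move: h; rewrite (card_priority R _ rN) (pot_cons _ _ _ pqm) /= -natr1.
have := bagv_le b ux.
case: (r \in Pr) prio => [_|/(_ isT)]; rewrite /=.
  have : \sum_(p <= k < q.-1) u k <= \sum_(p <= k < q.-1) x k by apply: ler_sum.
  have q1 : q = q.-1.+1 by rewrite prednK //; apply: leq_ltn_trans pq.
  have pq1 : (p <= q.-1)%N by rewrite -ltnS -q1.
  have : \sum_(p <= k < q) u k = \sum_(p <= k < q.-1) u k + u q.-1 by rewrite {1}q1 big_nat_recr.
  have : u q.-1 <= u (2 * n)%N by apply: ua; apply: leq_trans np pq1.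
  lra.
have : \sum_(p <= k < q) u k <= \sum_(p <= k < q) x k by apply: ler_sum.
lra.
Qed.

(** If everything were rejected, the potential would be less than [A] per bag. As [j] itself is
    counted in [N :&: Pr], the coefficient of [M] is nonnegative, so the invariant demands at least
    [A] per bag. *)
Lemma invP_progress (R : realFieldType) (T : finType) (Pr : {set T}) (A M : R) n m
    (u x : nat -> R) (N : {set T}) b L p (j : T) :
  (forall k, u k <= x k) -> A <= M -> j \in N -> j \in Pr ->
  invP Pr A M n m u N (b :: L) p -> (forall c, c \in b :: L -> bagv x c < A) ->
  A <= bagv x b + \sum_(p <= k < m) x k.
Proof.
move=> ux AM jN jP [np LM h] hb; rewrite leNgt; apply/negP => hS.
move: h; rewrite /pot !big_cons /= -natr1.
have := bagv_le b ux.
have : \sum_(p <= k < m) u k <= \sum_(p <= k < m) x k by apply: ler_sum.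
have : \sum_(c <- L) bagv u c <= (size L)%:R * A.
  apply: (@le_trans _ _ (\sum_(c <- L) A)); last first.
    by rewrite big_const_seq count_predT iter_addr_0 mulr_natl.
  rewrite big_seq [leRHS]big_seq; apply: ler_sum => c cL.
  by apply: le_trans (bagv_le c ux) _; apply: ltW; apply: hb; rewrite in_cons cL orbT.
have : 0 <= (#|N :&: Pr|%:R - 1) * (M - A).
  apply: mulr_ge0; last by lra.
  by rewrite subr_ge0 ler1n card_gt0; apply/set0Pn; exists j; rewrite inE jN.
by lra.
Qed.

(** * Irreducible instances *)

Lemma perm_bag_goods (L : seq (nat * nat)) :
  perm_eq (bag_goods L) ([seq b.1 | b <- L] ++ [seq b.2 | b <- L]).
Proof.
elim: L => [|b L ih] //=; rewrite /bag_goods /= -/(bag_goods L) perm_cons.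
by rewrite perm_sym -cat1s perm_catCA /= perm_cons perm_sym.
Qed.

Definition outer_bags (n : nat) : seq (nat * nat) := [seq (k, (2 * n - k.+1)%N) | k <- iota 0 n].
Definition adjacent_bags (n : nat) : seq (nat * nat) := [seq ((2 * k)%N, (2 * k).+1) | k <- iota 0 n].

Lemma perm_outer_bags n : perm_eq (bag_goods (outer_bags n)) (iota 0 (2 * n)).
Proof.
rewrite (perm_trans (perm_bag_goods _)) // -!map_comp /=.
have -> : [seq (fst \o (fun k => (k, (2 * n - k.+1)%N))) k | k <- iota 0 n] = iota 0 n.
  by rewrite -[RHS]map_id; apply: eq_map.
have -> : iota 0 (2 * n) = iota 0 n ++ iota n n by rewrite mul2n -addnn iotaD.
rewrite perm_cat2l; apply: uniq_perm.
- rewrite map_inj_in_uniq ?iota_uniq // => i j; rewrite !mem_iota /=; lia.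
- exact: iota_uniq.
move=> g; rewrite mem_iota; apply/mapP/idP => [[k]|gn].
  by rewrite mem_iota /= => kn ->; lia.
by exists (2 * n - g.+1)%N; [rewrite mem_iota; lia | rewrite /=; lia].
Qed.

Lemma perm_adjacent_bags n : perm_eq (bag_goods (adjacent_bags n)) (iota 0 (2 * n)).
Proof.
have h k : bag_goods [seq ((2 * i)%N, (2 * i).+1) | i <- iota k n] = iota (2 * k) (2 * n).
  elim: n k => [//|n ih] k; rewrite [RHS](_ : _ = [:: (2 * k)%N; (2 * k).+1] ++ iota (2 * k.+1) (2 * n)).
    by rewrite -ih.
  have -> : (2 * n.+1 = (2 * n).+2)%N by rewrite mulnS.
  by have -> : (2 * k.+1 = (2 * k).+2)%N by rewrite mulnS.
by rewrite /adjacent_bags h.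
Qed.

Lemma perm_all_goods n m (L : seq (nat * nat)) : (2 * n <= m)%N ->
  perm_eq (bag_goods L) (iota 0 (2 * n)) ->
  perm_eq (bag_goods L ++ index_iota (2 * n) m) (index_iota 0 m).
Proof.
move=> nm pL; rewrite (_ : index_iota 0 m = iota 0 (2 * n) ++ index_iota (2 * n) m).
  by rewrite perm_cat2r.
by rewrite /index_iota subn0 -{2}(add0n (2 * n)%N) -iotaD subnKC.
Qed.

Lemma pot_all (R : realFieldType) n m (L : seq (nat * nat)) (w : nat -> R) : (2 * n <= m)%N ->
  perm_eq (bag_goods L) (iota 0 (2 * n)) -> pot m w L (2 * n) = \sum_(g < m) w g.
Proof.
move=> nm pL; rewrite /pot -sum_bag_goods -big_cat /= (perm_big _ (perm_all_goods nm pL)) /=.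
by rewrite big_mkord.
Qed.

(** Each crossing is at most the drop of the threshold indicator [z] from one pair to the next, and
    these drops telescope. *)
Lemma sum_crossing_le1 (R : realFieldType) (d : R) (u : nat -> R) n : antitone u ->
  \sum_(b <- adjacent_bags n) crossing d u b <= 1.
Proof.
move=> ua; rewrite /adjacent_bags big_map.
pose z k : R := (3 / 8 + d / 2 < u k)%R%:R.
suff : \sum_(k <- iota 0 n) crossing d u ((2 * k)%N, (2 * k).+1) <= z 0%N - z (2 * n)%N.
  move/le_trans; apply; rewrite /z; do 2!case: (_ < _); rewrite /=; lra.
elim: n => [|n ih]; first by rewrite big_nil muln0 subrr.
rewrite -addn1 iotaD big_cat /= big_seq1 add0n.
have h1 : u (2 * n).+1 <= u (2 * n)%N by apply: ua.
have h2 : u (2 * n.+1)%N <= u (2 * n).+1 by apply: ua; rewrite mulnS; lia.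
move: ih; rewrite addn1 /z /crossing /=.
case: (ltP _ (u (2 * n.+1)%N)) => ?; case: (ltP _ (u (2 * n)%N)) => ?;
  case: (leP (u (2 * n).+1) _) => ?; case: (ltP _ (u 0%N)) => ?; rewrite /=; lra.
Qed.

Lemma pairs_ok_adjacent n : pairs_ok n (adjacent_bags n).
Proof.
apply/andP; split.
  by apply/allP => b /mapP[k]; rewrite mem_iota => kn -> /=; lia.
rewrite /adjacent_bags pairwise_map; apply: sub_pairwise (_ : pairwise ltn (iota 0 n)).
  by move=> i j /= ij; lia.
by rewrite -sorted_pairwise ?iota_ltn_sorted //; exact: ltn_trans.
Qed.

Lemma sum_blocks_psi (R : realFieldType) (d : R) (psi : R -> R) n m (u : nat -> R) (f : nat -> nat) :
  (forall l : seq R, all (fun x => (0 <= x) && (x <= 1 / 2 + 2 * d)) l ->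
    1 <= \sum_(x <- l) x -> 1 <= \sum_(x <- l) psi x) ->
  (forall k, 0 <= u k <= 1 / 2 + 2 * d) -> (forall g, (g < m)%N -> (f g < n)%N) ->
  (forall j, (j < n)%N -> 1 <= \sum_(g < m | f g == j) u g) ->
  n%:R <= \sum_(g < m) psi (u g).
Proof.
move=> hpsi ub fn s1; rewrite (sum_blocks (fun g => psi (u g)) fn).
rewrite -[n in leLHS]card_ord -sumr_const; apply: ler_sum => j _.
have := hpsi (map (fun g : 'I_m => u g) (filter (fun g : 'I_m => f g == j) (index_enum 'I_m))).
rewrite !big_map !big_filter; apply; last exact: s1.
by apply/allP => x /mapP[g _ ->]; apply: ub.
Qed.

(** The four inequalities express irreducibility; the third is what the rejection of the triple
    yields for its smallest good. *)
Lemma final_stage (R : realFieldType) (T : finType) (x : T -> nat -> R) (d : R) (n m : nat)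
    (N : {set T}) : T -> 0 < d -> 15 * (21 * d) <= 1 -> #|N| = n -> (2 * n < m)%N ->
  (forall i, antitone (x i)) -> (forall i k, 0 <= x i k) ->
  (forall i, i \in N -> exists2 f : nat -> nat, forall g, (g < m)%N -> (f g < n)%N &
    forall j, (j < n)%N -> 1 <= \sum_(g < m | f g == j) phi d (x i g)) ->
  (forall i, i \in N -> [/\ x i 0%N < 3 / 4 + d, x i n.-1 + x i n < 3 / 4 + d,
     x i (2 * n)%N < 1 / 4 + d / 3 & x i 0%N + x i (2 * n)%N < 3 / 4 + d]) ->
  exists o : nat -> T, forall i, i \in N -> 3 / 4 + d <= \sum_(g < m | o g == i) x i g.
Proof.
move=> t0 d0 d1 cN nm xa x0 part irr.
pose u i k := phi d (x i k).
have ua i : antitone (u i) by move=> j k jk; apply: phi_mono => //; apply: xa.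
have u0 i k : 0 <= u i k by apply: phi_ge0.
(* Since [x i 0] is below [3 / 4 + d], the jump of [phi] to [1] never occurs, and [phi] only rounds
   down. *)
have ux i k : i \in N -> u i k <= x i k.
  move=> /irr[h _ _ _]; have hk : x i k <= x i 0%N by apply: xa.
  rewrite /u; clear -h hk d0 d1.
  by case: (phi_cases (x i k) d0 d1) => [[? ->]|[? ? ->]|[? ? ->]|[? [[-> ?]|[-> ?]]]]; lra.
have u34 i k : i \in N -> u i k <= 3 / 4.
  move=> /irr[h _ _ _]; have hk : x i k <= x i 0%N by apply: xa.
  rewrite /u; clear -h hk d0 d1.
  by case: (phi_cases (x i k) d0 d1) => [[? ->]|[? ? ->]|[? ? ->]|[? [[-> ?]|[-> ?]]]]; lra.
have u14 i : i \in N -> u i (2 * n)%N <= 1 / 4.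
  move=> /irr[_ _ h _]; rewrite /u; clear -h d0 d1.
  by case: (phi_cases (x i (2 * n)%N) d0 d1) => [[? ->]|[? ? ->]|[? ? ->]|[? [[-> ?]|[-> ?]]]]; lra.
have sumu i : i \in N -> n%:R <= \sum_(g < m) u i g.
  move=> /part[f fn s1]; rewrite (sum_blocks (u i) fn).
  by rewrite -[n in leLHS]card_ord -sumr_const; apply: ler_sum => j _; apply: s1.
pose B := [set i in N | 1 / 4 - d <= u i (2 * n)%N].
pose A := N :\: B.
have nm' := ltnW nm.
have subu i (L : seq (nat * nat)) : i \in N -> (forall b', b' \in L -> bagv (x i) b' < 3 / 4 + d) ->
    (forall b', b' \in L -> bagv (u i) b' < 3 / 4 + d).
  by move=> iN h b' /h; apply: le_lt_trans; apply: bagv_le => k; apply: ux.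
have finish L (o : nat -> T) : perm_eq (bag_goods L) (iota 0 (2 * n)) ->
    (forall i, i \in N -> 3 / 4 + d <= \sum_(g <- bag_goods L ++ index_iota (2 * n) m | o g == i) x i g) ->
    exists o : nat -> T, forall i, i \in N -> 3 / 4 + d <= \sum_(g < m | o g == i) x i g.
  move=> pL oP; exists o => i /oP; rewrite (perm_big _ (perm_all_goods nm' pL)) /=.
  by rewrite big_mkord.
have uniqL L : perm_eq (bag_goods L) (iota 0 (2 * n)) -> uniq (bag_goods L ++ index_iota (2 * n) m).
  by move=> pL; rewrite (perm_uniq (perm_all_goods nm' pL)) iota_uniq.
have cAB : #|A|%:R = n%:R - #|B|%:R :> R.
  have BN : B \subset N by apply/subsetP => i; rewrite inE => /andP[].
  by rewrite /A cardsD (setIidPr BN) cN natrB // -cN subset_leq_card.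
have d4 : 0 <= d * n%:R by apply: mulr_ge0; [exact: ltW | exact: ler0n].
have [few|many] := leP #|B|%:R (n%:R - 4 * (d * n%:R)).
(* Few critical agents: they form the priority class [B]. The value [M = 1 + d] is the least that
   leaves room for a last good worth [1 / 4] in [invP_fill]. *)
- have pL := perm_outer_bags n.
  pose I j (N' : {set T}) L p := j \in N /\ if j \in B then invP B (3 / 4 + d) (1 + d) n m (u j) N' L p
    else invC (3 / 4 + d) n m (x j) L p.
  have [||||||o oP] := @bag_filling R T x (3 / 4 + d) m B I t0 x0 _ _ _ N (outer_bags n) (2 * n)%N.
  + move=> N' L p j r b jN' rN' jr bL [jN h] prio; split => //; move: h.
    case: ifP => jB; last exact: invC_take.
    move=> h; apply: (invP_take _ rN' bL h) => [k|]; first exact: ux.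
    exact: prio.
  + move=> N' b L p q j r jN' rN' jr pq [jN h] _ hS prio; split => //; move: h.
    case: ifP => jB h; last exact: invC_fill h hS.
    apply: (invP_fill (ua j) _ _ _ rN' pq h hS) => [k|||]; [exact: ux | exact: u14 | lra |].
    exact: prio.
  + move=> N' b L p j jN' [jN h] _ hb; move: h.
    case: ifP => jB h; last exact: invC_progress h.
    by apply: (invP_progress _ _ jN' jB h hb) => [k|]; [exact: ux | lra].
  + by rewrite size_map size_iota.
  + exact: uniqL.
  + move=> j jN; split => //; case: ifP => jB.
      split => //.
        (* The largest good is at most [1 / 2 + 2 * d], because good [2 * n] is worth at least
           [1 / 4 - d] and the two together are rejected. Good [n] is at most half of
           [3 / 4 + d]. *)
        move=> b /mapP[k]; rewrite mem_iota => kn ->; rewrite /bagv /=.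
        have uk : u j k <= u j 0%N by apply: ua.
        have k2 : u j (2 * n - k.+1)%N <= u j n by apply: ua; clear -kn; lia.
        have n1 : u j n <= u j n.-1 by apply: ua; exact: leq_pred.
        have := ux j n jN; have := ux j n.-1 jN; have := ux j 0%N jN; have := ux j (2 * n)%N jN.
        have := irr j jN => -[_ h2 _ h4]; move: jB; rewrite inE jN /= => hB ? ? ? ?.
        by lra.
      rewrite (pot_all _ nm' pL) size_map size_iota.
      have -> : N :&: B = B by apply/setIidPr/subsetP => i; rewrite inE => /andP[].
      (* The inequality needed amounts to [#|B| - 1 <= n - 4 * (d * n)]. *)
      by have := sumu j jN; lra.
    have [f fn s1] := part j jN.
    have [w [f' [wa w0 fn' s1']]] := normalized_order (ua j) (u0 j) fn s1.
    have w0' k : 0 <= w k by case/andP: (w0 k).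
    have wu k : w k <= u j k by case/andP: (w0 k).
    have [|||beta [b1 b2 b3]] := cost_bound d0 d1 wa w0' fn' s1' nm.
    * by apply: le_trans (wu _) _; apply: u34.
    * apply: le_trans (wu _) _; move: jB; rewrite inE jN /= => /negbT; rewrite -ltNge; exact: ltW.
    * have := irr j jN => -[_ _ _ h4]; have := wu 0%N; have := wu (2 * n)%N.
      by have := ux j 0%N jN; have := ux j (2 * n)%N jN; lra.
    exists w, beta; split => //; first by move=> k; apply: le_trans (wu k) (ux j k jN).
    split => //; rewrite (pot_all _ nm' pL) (sum_blocks w fn').
    rewrite [leRHS](eq_bigr (fun=> 1)) => [|i _]; last exact: s1'.
    rewrite sumr_const card_ord; apply: le_trans b3.
    by rewrite /outer_bags big_map /index_iota subn0.
  exact: finish pL oP.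
(* Many critical agents: fewer than [4 * (d * n)] others remain, so few that the crude bound
   [M = 3 / 2] suffices for this priority class. *)
have pL := perm_adjacent_bags n.
have AP i : i \in N -> (i \in A) = (u i (2 * n)%N < 1 / 4 - d).
  by move=> iN; rewrite !inE iN andbT ltNge.
pose I j (N' : {set T}) L p := j \in N /\ if j \in A then invP A (3 / 4 + d) (3 / 2) n m (u j) N' L p
    else invB d n m (u j) L p.
have [||||||o oP] := @bag_filling R T x (3 / 4 + d) m A I t0 x0 _ _ _ N (adjacent_bags n) (2 * n)%N.
+ move=> N' L p j r b jN' rN' jr bL [jN h] prio; split => //; move: h.
  case: ifP => jA; last exact: invB_take.
  move=> h; apply: (invP_take _ rN' bL h) => [k|]; first exact: ux.
  exact: prio.
+ move=> N' b L p q j r jN' rN' jr pq [jN h] hb hS prio; split => //; move: h.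
  case: ifP => jA h.
    apply: (invP_fill (ua j) _ _ _ rN' pq h hS) => [k|||]; [exact: ux | exact: u14 | lra |].
    exact: prio.
  apply: (invB_fill d0 d1 (ua j) (u0 j) _ (u14 j jN) pq h).
  * by move/negbT: jA; rewrite AP // -leNgt.
  * by apply: (subu j _ jN hb); apply: mem_head.
  * apply: le_lt_trans hS; apply: lerD; first by apply: bagv_le => k; apply: ux.
    by apply: ler_sum => k _; apply: ux.
+ move=> N' b L p j jN' [jN h] _ hb; move: h.
  case: ifP => jA h.
    by apply: (invP_progress _ _ jN' jA h hb) => [k|]; [exact: ux | lra].
  have jA' : 1 / 4 - d <= u j (2 * n)%N by move/negbT: jA; rewrite AP // -leNgt.
  apply: le_trans (invB_progress d0 d1 (ua j) (u0 j) jA' (u14 j jN) h _) _.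
    exact: (subu j _ jN hb).
  apply: lerD; first by apply: bagv_le => k; apply: ux.
  by apply: ler_sum => k _; apply: ux.
+ by rewrite size_map size_iota.
+ exact: uniqL.
+ move=> j jN; split => //; case: ifP => jA.
    split => //.
      move=> b /mapP[k _ ->]; rewrite /bagv /=.
      by have := u34 j (2 * k)%N jN; have := u34 j (2 * k).+1 jN; lra.
    rewrite (pot_all _ nm' pL) size_map size_iota.
    have -> : N :&: A = A by apply/setIidPr/subsetP => i; rewrite inE => /andP[].
    have dA : 0 <= d * #|A|%:R by apply: mulr_ge0; [exact: ltW | exact: ler0n].
    have An : (d * 15 * 21) * n%:R <= n%:R by rewrite ler_piMl ?ler0n //; lra.
    by have := sumu j jN; move: cAB; lra.
  have jA' : 1 / 4 - d <= u j (2 * n)%N by move/negbT: jA; rewrite AP // -leNgt.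
  have [f fn s1] := part j jN.
  have ub k : 0 <= u j k <= 1 / 2 + 2 * d.
    rewrite u0 /=; have uk : u j k <= u j 0%N by apply: ua.
    have := irr j jN => -[_ _ _ h4].
    by have := ux j 0%N jN; have := ux j (2 * n)%N jN; lra.
  split => //; first exact: pairs_ok_adjacent.
  have Sx := sum_blocks_psi (fun l => @psix_sum R d l d0 d1) ub fn s1.
  have Sy := sum_blocks_psi (fun l => @psiy_sum R d l d0 d1) ub fn s1.
  have cr : d * \sum_(b <- adjacent_bags n) crossing d (u j) b <= d * 1.
    by apply: ler_wpM2l; [exact: ltW | apply: sum_crossing_le1].
  (* At most one pair crosses, so the allowances [4 * d] and [14 * d] cover the initial charges. *)
  constructor 1; rewrite !(pot_all _ nm' pL) size_map size_iota /=.
  by split; lra.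
exact: finish pL oP.
Qed.

(** * Reductions *)

Definition splits (R : realFieldType) (n : nat) (s : seq nat) (u : nat -> R) (f : nat -> nat) :=
  forall k, (k < n)%N -> 1 <= \sum_(g <- s | f g == k) u g.

Lemma splits_total (R : realFieldType) n s (u : nat -> R) f :
  (forall k, 0 <= u k) -> (0 < n)%N -> splits n s u f ->
  exists2 f', splits n s u f' & forall g, (f' g < n)%N.
Proof.
move=> u0 n0 sf; exists (fun g => if (f g < n)%N then f g else 0%N); last by move=> g; case: ifP.
move=> k kn; apply: le_trans (sf k kn) _.
rewrite big_mkcond [leRHS]big_mkcond; apply: ler_sum => g _.
by have := u0 g; case: (eqVneq (f g) k) => [->|_] ug; [rewrite kn eqxx | case: ifP].
Qed.

(** Block [k0] is given up: its label is exchanged with the label [n], which is out of range for [n]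
    blocks. *)
Lemma splits_remove (R : realFieldType) n s (u : nat -> R) f k0 (D : seq nat) :
  (forall k, (k < n.+1)%N -> k != k0 -> 1 <= \sum_(g <- s | f g == k) u g) ->
  (forall g, g \in D -> f g = k0) ->
  exists f', splits n [seq g <- s | g \notin D] u f'.
Proof.
move=> sf fD; exists (fun g => if f g == k0 then n else if f g == n then k0 else f g) => k kn.
pose t := if k == k0 then n else k.
have tk0 : t != k0 by rewrite /t; case: (eqVneq k k0) => // kk; rewrite -kk gtn_eqF.
have tn : (t < n.+1)%N by rewrite /t; case: ifP => // _; apply: leq_trans kn _.
apply: le_trans (sf t tn tk0) _; rewrite big_filter_cond le_eqVlt; apply/orP; left; apply/eqP.
apply: eq_bigl => g; case: (boolP (g \in D)) => [/fD ->|_] /=.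
  by rewrite eq_sym (negPf tk0).
case: (eqVneq (f g) k0) => [->|fk]; first by rewrite [LHS]eq_sym (negPf tk0) gtn_eqF.
rewrite /t; case: (eqVneq k k0) => [->|kk].
  by case: (eqVneq (f g) n) => [_|_]; rewrite ?eqxx // (negPf fk).
case: (eqVneq (f g) n) => [->|//].
by rewrite eq_sym ltn_eqF // eq_sym (negPf kk).
Qed.

Definition swap (a b g : nat) : nat := if g == a then b else if g == b then a else g.

Lemma swapK a b : involutive (swap a b).
Proof.
move=> g; rewrite /swap; case: (eqVneq g a) => [->|ga].
  by rewrite eqxx; case: eqVneq.
by case: (eqVneq g b) => [->|gb]; rewrite ?eqxx // (negPf ga) (negPf gb).
Qed.

Lemma swap_r a b : swap a b b = a.
Proof. by rewrite /swap eqxx; case: eqP. Qed.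

Lemma swap_id a b g : g != a -> g != b -> swap a b g = g.
Proof. by rewrite /swap => /negPf -> /negPf ->. Qed.

(** Block [k0] is about to be given up, so it may trade [a] for the less valuable [b]; another block
    that held [b] can only gain. *)
Lemma splits_swap (R : realFieldType) n s (u : nat -> R) f k0 a b :
  uniq s -> a \in s -> b \in s -> u b <= u a -> f a = k0 ->
  (forall k, (k < n)%N -> k != k0 -> 1 <= \sum_(g <- s | f g == k) u g) ->
  forall k, (k < n)%N -> k != k0 -> 1 <= \sum_(g <- s | f (swap a b g) == k) u g.
Proof.
move=> us aS bS ba fa sf k kn kk; apply: le_trans (sf k kn kk) _.
have pe : perm_eq [seq swap a b g | g <- s] s.
  apply: uniq_perm => //; first by rewrite map_inj_uniq //; apply: inv_inj; apply: swapK.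
  move=> g; apply/mapP/idP => [[h hs ->]|gs].
    by rewrite /swap; case: eqP => // _; case: eqP.
  exists (swap a b g); last by rewrite swapK.
  by rewrite /swap; case: eqP => // _; case: eqP.
rewrite -[leRHS](perm_big _ pe) big_map /=.
rewrite [leRHS](eq_bigl (fun g => f g == k)); last by move=> g; rewrite swapK.
apply: ler_sum => g /eqP fg; rewrite /swap.
have ga : g != a by apply: contra kk => /eqP ga; rewrite -fg ga fa.
by rewrite (negPf ga); case: eqP => // ->.
Qed.

Lemma pigeonhole (n M c : nat) (F : nat -> nat) : (forall i, (F i < n)%N) -> (c * n < M)%N ->
  exists2 k, (k < n)%N & (c < size [seq i <- iota 0 M | F i == k])%N.
Proof.
move=> Fn cM; case: (pickP (fun k : 'I_n => (c < size [seq i <- iota 0 M | F i == k])%N)) => [k kc|none].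
  by exists k.
exfalso; move: cM; rewrite ltnNge; move/negP; apply.
rewrite -[M in (M <= _)%N]card_ord -sum1_card (sum_blocks (fun=> 1%N) (fun g _ => Fn g)).
apply: (@leq_trans (\sum_(j < n) c)%N); last by rewrite sum_nat_const card_ord mulnC.
apply: leq_sum => j _; have := none j => /negbT; rewrite -leqNgt.
by rewrite size_filter -sum1_count -{1}(subn0 M) -/(index_iota 0 M) big_mkord.
Qed.

Lemma mem_filter_pos M F (k i : nat) l r : [seq j <- iota 0 M | F j == k] = l ++ i :: r -> (i < M)%N /\ F i = k :> nat.
Proof.
move=> E; have : i \in [seq j <- iota 0 M | F j == k] by rewrite E mem_cat mem_head orbT.
by rewrite mem_filter mem_iota => /andP[/eqP -> /=].
Qed.

(** Two of the first [n + 2] goods share one of the [n + 1] blocks. Exchanging them for the last two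
    of these goods harms no other block, and then their block is removed. *)
Lemma reduce_pair (R : realFieldType) n s (u : nat -> R) f :
  sorted ltn s -> antitone u -> (forall k, 0 <= u k) -> (n.+1 < size s)%N -> splits n.+1 s u f ->
  exists f', splits n [seq g <- s | g \notin [:: nth 0%N s n; nth 0%N s n.+1]] u f'.
Proof.
move=> ss ua u0 sz sf0; have [f1 sf fn] := splits_total u0 (ltn0Sn n) sf0.
have us : uniq s by apply: sorted_uniq ss; [exact: ltn_trans | exact: ltnn].
have sn i j : (i <= j)%N -> (j < size s)%N -> u (nth 0%N s j) <= u (nth 0%N s i).
  move=> ij js; apply: ua; rewrite (sorted_leq_nth leq_trans leqnn 0%N) ?inE //.
    by apply: sub_sorted ss => a b; exact: ltnW.
  exact: leq_ltn_trans ij js.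
have [|k kn] := @pigeonhole n.+1 n.+2 1 (fun i => f1 (nth 0%N s i)) (fun i => fn _); first by rewrite mul1n.
set l := [seq _ <- _ | _].
have sl : sorted ltn l by apply: sorted_filter; [exact: ltn_trans | exact: iota_ltn_sorted].
case El : l sl => [//|a [//|b r]] /= /andP[ab _] _.
have [a1 fa] := @mem_filter_pos _ _ k a [::] _ El.
have [b1 fb] := @mem_filter_pos _ _ k b [:: a] _ El.
have bs : (b < size s)%N by apply: leq_trans b1 _.
have as' : (a < size s)%N by apply: ltn_trans ab bs.
have ns : (n < size s)%N by apply: ltn_trans (ltnSn n) sz.
have inj i j : (i < size s)%N -> (j < size s)%N -> (nth 0%N s i == nth 0%N s j) = (i == j).
  by move=> *; rewrite nth_uniq.
have sf1 k' : (k' < n.+1)%N -> k' != k -> 1 <= \sum_(g <- s | f1 g == k') u g by move=> h _; apply: sf.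
have h1 := splits_swap us (mem_nth 0%N bs) (mem_nth 0%N sz) (sn b n.+1 b1 sz) fb sf1.
set g1 := swap (nth 0%N s b) (nth 0%N s n.+1) in h1.
have an : (a <= n)%N by rewrite -ltnS; exact: leq_trans ab b1.
have fa1 : f1 (g1 (nth 0%N s a)) = k.
  by rewrite /g1 swap_id // inj // ltn_eqF.
have h2 := splits_swap us (mem_nth 0%N as') (mem_nth 0%N ns) (sn a n an ns) fa1 h1.
apply: (splits_remove h2) => g; rewrite !inE => /orP[/eqP ->|/eqP ->] /=.
  by rewrite swap_r.
by rewrite swap_id ?inj ?gtn_eqF // /g1 swap_r.
Qed.

(** As for [reduce_pair], with three of the first [2 * n + 3] goods in one block. The exchanges go
    from the last good downwards, so that each good is still in place when its turn comes. *)
Lemma reduce_triple (R : realFieldType) n s (u : nat -> R) f :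
  sorted ltn s -> antitone u -> (forall k, 0 <= u k) -> ((2 * n).+2 < size s)%N -> splits n.+1 s u f ->
  exists f', splits n [seq g <- s | g \notin
    [:: nth 0%N s (2 * n); nth 0%N s (2 * n).+1; nth 0%N s (2 * n).+2]] u f'.
Proof.
move=> ss ua u0 sz sf0; have [f1 sf fn] := splits_total u0 (ltn0Sn n) sf0.
have us : uniq s by apply: sorted_uniq ss; [exact: ltn_trans | exact: ltnn].
have sn i j : (i <= j)%N -> (j < size s)%N -> u (nth 0%N s j) <= u (nth 0%N s i).
  move=> ij js; apply: ua; rewrite (sorted_leq_nth leq_trans leqnn 0%N) ?inE //.
    by apply: sub_sorted ss => a b; exact: ltnW.
  exact: leq_ltn_trans ij js.
have [|k kn] := @pigeonhole n.+1 (2 * n).+3 2 (fun i => f1 (nth 0%N s i)) (fun i => fn _).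
  by rewrite mulnS.
set l := [seq _ <- _ | _].
have sl : sorted ltn l by apply: sorted_filter; [exact: ltn_trans | exact: iota_ltn_sorted].
case El : l sl => [//|a [//|b [//|c r]]] /= /and3P[ab bc _] _.
have [a1 fa] := @mem_filter_pos _ _ k a [::] _ El.
have [b1 fb] := @mem_filter_pos _ _ k b [:: a] _ El.
have [c1 fc] := @mem_filter_pos _ _ k c [:: a; b] _ El.
have cs : (c < size s)%N by apply: leq_trans c1 _.
have bs : (b < size s)%N by apply: ltn_trans bc cs.
have as' : (a < size s)%N by apply: ltn_trans ab bs.
have sz1 : ((2 * n).+1 < size s)%N by apply: ltn_trans sz.
have sz0 : (2 * n < size s)%N by apply: ltn_trans sz1.
have b2 : (b <= (2 * n).+1)%N by rewrite -ltnS; exact: leq_trans bc c1.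
have a2 : (a <= 2 * n)%N by rewrite -ltnS; exact: leq_trans ab b2.
have inj i j : (i < size s)%N -> (j < size s)%N -> (nth 0%N s i == nth 0%N s j) = (i == j).
  by move=> *; rewrite nth_uniq.
have sf1 k' : (k' < n.+1)%N -> k' != k -> 1 <= \sum_(g <- s | f1 g == k') u g by move=> h _; apply: sf.
have h1 := splits_swap us (mem_nth 0%N cs) (mem_nth 0%N sz) (sn c _ c1 sz) fc sf1.
set g1 := swap (nth 0%N s c) _ in h1.
have fb1 : f1 (g1 (nth 0%N s b)) = k by rewrite /g1 swap_id // inj // ltn_eqF.
have h2 := splits_swap us (mem_nth 0%N bs) (mem_nth 0%N sz1) (sn b _ b2 sz1) fb1 h1.
rewrite /= in h2; set g2 := swap (nth 0%N s b) _ in h2.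
have ac : (a < c)%N by apply: ltn_trans bc.
have fa2 : f1 (g1 (g2 (nth 0%N s a))) = k.
  have -> : g2 (nth 0%N s a) = nth 0%N s a by rewrite /g2 swap_id // inj // ltn_eqF.
  by rewrite /g1 swap_id // inj // ltn_eqF // (leq_ltn_trans a2).
have h3 := splits_swap us (mem_nth 0%N as') (mem_nth 0%N sz0) (sn a _ a2 sz0) fa2 h2.
apply: (splits_remove h3) => g; rewrite !inE => /or3P[/eqP ->|/eqP ->|/eqP ->] /=.
- by rewrite swap_r.
- rewrite [swap (nth 0%N s a) _ _]swap_id ?inj ?gtn_eqF //.
  by rewrite /g2 swap_r.
have b3 : (b < (2 * n).+2)%N by [].
rewrite [swap (nth 0%N s a) _ _]swap_id ?inj ?gtn_eqF // ?(leq_ltn_trans a2) //.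
by rewrite /g2 swap_id ?inj ?gtn_eqF // /g1 swap_r.
Qed.

Lemma reduce_first (R : realFieldType) n s (u : nat -> R) f :
  splits n.+1 s u f -> (forall k, 0 <= u k) ->
  exists f', splits n [seq g <- s | g \notin [:: nth 0%N s 0]] u f'.
Proof.
move=> sf0 u0; have [f1 sf fn] := splits_total u0 (ltn0Sn n) sf0.
apply: (@splits_remove R n s u f1 (f1 (nth 0%N s 0))) => [k kn _|g]; first exact: sf.
by rewrite inE => /eqP ->.
Qed.

(** If [a] and [b] lie in different blocks, the remainders of the two blocks are united: they are
    worth at least [2 - (u a + u b) >= 1]. *)
Lemma reduce_merge (R : realFieldType) n s (u : nat -> R) f a b :
  uniq s -> (forall k, 0 <= u k) -> a \in s -> b \in s -> a != b -> u a + u b <= 1 ->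
  splits n.+1 s u f -> exists f', splits n [seq g <- s | g \notin [:: a; b]] u f'.
Proof.
move=> us u0 aS bS ab uab sf0; have [f1 sf fn] := splits_total u0 (ltn0Sn n) sf0.
have [fab|fab] := eqVneq (f1 a) (f1 b).
  apply: (@splits_remove R n s u f1 (f1 a)) => [k kn _|g]; first exact: sf.
  by rewrite !inE => /orP[/eqP ->|/eqP ->].
pose f2 g := if g \in [:: a; b] then f1 b else if f1 g == f1 b then f1 a else f1 g.
apply: (@splits_remove R n s u f2 (f1 b)) => [k kn kb|g]; last by rewrite /f2 => ->.
have [ka|ka] := eqVneq k (f1 a); last first.
  apply: le_trans (sf k kn) _; rewrite le_eqVlt; apply/orP; left; apply/eqP; apply: eq_bigl => g.
  rewrite /f2 !inE; case: (eqVneq g a) => [->|ga] /=.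
    by rewrite eq_sym (negPf ka) eq_sym (negPf kb).
  case: (eqVneq g b) => [->|gb] //=.
  by case: (eqVneq (f1 g) (f1 b)) => [->|//]; rewrite eq_sym (negPf kb) eq_sym (negPf ka).
have s1 := sf (f1 a) (fn a); have s2 := sf (f1 b) (fn b).
have D1 c : c \in s -> \sum_(g <- s | f1 g == f1 c) u g =
    u c + \sum_(g <- s | (f1 g == f1 c) && (g != c)) u g.
  by move=> cS; rewrite big_mkcond (bigD1_seq c) //= eqxx -big_mkcondl.
rewrite D1 // in s1; rewrite D1 // in s2.
have -> : \sum_(g <- s | f2 g == k) u g =
    \sum_(g <- s | (f1 g == f1 a) && (g != a)) u g + \sum_(g <- s | (f1 g == f1 b) && (g != b)) u g.
  rewrite big_mkcond [X in _ = X + _]big_mkcond [X in _ = _ + X]big_mkcond -big_split /=.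
  have fba : (f1 b == f1 a) = false by rewrite eq_sym (negPf fab).
  apply: eq_bigr => g _; rewrite /f2 !inE ka; case: (eqVneq g a) => [->|ga] /=.
    by rewrite ?eqxx ?andbF ?fba ?(negPf fab) /= ?addr0.
  case: (eqVneq g b) => [->|gb] /=; first by rewrite ?eqxx ?andbF ?fba /= ?addr0.
  rewrite !andbT; case: (eqVneq (f1 g) (f1 b)) => [->|fb].
    by rewrite ?eqxx ?fba ?add0r.
  by rewrite addr0.
lra.
Qed.

Lemma final_stage_seq (R : realFieldType) (T : finType) (x : T -> nat -> R) (d : R) (n : nat)
    (N : {set T}) (s : seq nat) : T -> 0 < d -> 15 * (21 * d) <= 1 -> #|N| = n.+1 ->
  (2 * n.+1 < size s)%N -> sorted ltn s ->
  (forall i, antitone (x i)) -> (forall i k, 0 <= x i k) ->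
  (forall i, i \in N -> exists f, splits n.+1 s (phi d \o x i) f) ->
  (forall i, i \in N -> [/\ x i (nth 0 s 0)%N < 3 / 4 + d,
     x i (nth 0 s n)%N + x i (nth 0 s n.+1)%N < 3 / 4 + d,
     x i (nth 0 s (2 * n.+1))%N < 1 / 4 + d / 3 &
     x i (nth 0 s 0)%N + x i (nth 0 s (2 * n.+1))%N < 3 / 4 + d]) ->
  exists o : nat -> T, forall i, i \in N -> 3 / 4 + d <= \sum_(g <- s | o g == i) x i g.
Proof.
move=> t0 d0 d1 cN sz ss xa x0 part irr.
have us : uniq s by apply: sorted_uniq ss; [exact: ltn_trans | exact: ltnn].
pose y i k := if (k < size s)%N then x i (nth 0 s k)%N else 0.
have yE i k : (k < size s)%N -> y i k = x i (nth 0 s k)%N by rewrite /y => ->.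
have [||||o oP] := @final_stage R T y d n.+1 (size s) N t0 d0 d1 cN sz.
- move=> i j k jk; rewrite /y; case: ifP => ks.
    rewrite (leq_ltn_trans jk ks); apply: xa.
    rewrite (sorted_leq_nth leq_trans leqnn 0%N) ?inE //; last exact: leq_ltn_trans jk ks.
    by apply: sub_sorted ss => a b; exact: ltnW.
  by case: ifP.
- by move=> i k; rewrite /y; case: ifP.
- move=> i iN; have [f sf] := part i iN.
  have [f1 sf1 fn] := splits_total (fun k => phi_ge0 d0 d1 (x0 i k)) (ltn0Sn n) sf.
  exists (fun k => f1 (nth 0 s k)%N) => [g _|j jn]; first exact: fn.
  apply: le_trans (sf1 j jn) _; rewrite (big_nth 0%N) big_mkord le_eqVlt; apply/orP; left; apply/eqP.
  by apply: eq_bigr => g _; rewrite yE.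
- move=> i /irr[h1 h2 h3 h4]; split; rewrite ?yE //.
  + exact: leq_ltn_trans sz.
  + by apply: leq_ltn_trans sz; rewrite leq_pmull.
  + by apply: leq_ltn_trans sz; rewrite /= mulnS; lia.
  + exact: leq_ltn_trans sz.
exists (fun g => o (index g s)) => i iN; apply: le_trans (oP i iN) _.
rewrite (big_nth 0%N) big_mkord le_eqVlt; apply/orP; left; apply/eqP.
by apply: eq_big => [g|g _]; rewrite ?index_uniq ?yE.
Qed.

(** Induction on the number of agents: each reduction serves one agent with at most three goods,
    which preserves [3 * n < size s]. Blocks are tracked for the rounded values and acceptance for
    [x], so the loss by [phi] is incurred only once. *)
Lemma ordered_allocation (R : realFieldType) (T : finType) (x : T -> nat -> R) (d : R) :
  T -> 0 < d -> 15 * (21 * d) <= 1 -> (forall i, antitone (x i)) -> (forall i k, 0 <= x i k) ->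
  forall (n : nat) (N : {set T}) (s : seq nat), #|N| = n -> sorted ltn s -> (3 * n < size s)%N ->
  (forall i, i \in N -> exists f, splits n s (phi d \o x i) f) ->
  exists o : nat -> T, forall i, i \in N -> 3 / 4 + d <= \sum_(g <- s | o g == i) x i g.
Proof.
move=> t0 d0 d1 xa x0; elim=> [|n ih] N s cN ss sz part.
  have N0 : N = set0 by apply/eqP; rewrite -cards_eq0 cN.
  by exists (fun _ => t0) => i; rewrite N0 inE.
have us : uniq s by apply: sorted_uniq ss; [exact: ltn_trans | exact: ltnn].
have ua i : antitone (phi d \o x i) by move=> j k jk; apply: phi_mono => //; apply: xa.
have u0 i k : 0 <= (phi d \o x i) k by apply: phi_ge0.
have sz3 : ((2 * n).+2 < size s)%N by clear -sz; lia.
have sz2 : (n.+1 < size s)%N by clear -sz; lia.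
have reduce i (D : seq nat) : i \in N -> uniq D -> {subset D <= s} -> (size D <= 3)%N ->
    3 / 4 + d <= \sum_(g <- D) x i g ->
    (forall j, j \in N -> exists f', splits n [seq g <- s | g \notin D] (phi d \o x j) f') ->
    exists o : nat -> T, forall i, i \in N -> 3 / 4 + d <= \sum_(g <- s | o g == i) x i g.
  move=> iN uD Ds sD vD part'.
  have us' : uniq (D ++ [seq g <- s | g \notin D]).
    rewrite cat_uniq uD filter_uniq // andbT; apply/hasPn => g.
    by rewrite mem_filter => /andP[].
  have pe : perm_eq s (D ++ [seq g <- s | g \notin D]).
    apply: uniq_perm => // g; rewrite mem_cat mem_filter.
    by case: (boolP (g \in D)) => //= /Ds ->.
  have [||||o oP] := ih (N :\ i) [seq g <- s | g \notin D].
  - by have := cardsD1 i N; rewrite iN cN => -[].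
  - by apply: sorted_filter ss; exact: ltn_trans.
  - have := perm_size pe; rewrite size_cat; move: (size [seq g <- s | g \notin D]) => X; clear -sz sD; move: (size s) (size D) sz sD; lia.
  - by move=> j /setD1P[_ jN]; apply: part'.
  exists (fun g => if g \in D then i else o g) => j jN.
  rewrite (perm_big _ pe) /= (sum_pick _ _ _ _ us').
  case: (eqVneq i j) => [ij|ij].
    by rewrite -ij; apply: (le_trans vD); rewrite lerDl; apply: sumr_ge0.
  by rewrite add0r; apply: oP; rewrite !inE eq_sym ij.
have inj i j : (i < size s)%N -> (j < size s)%N -> (nth 0%N s i == nth 0%N s j) = (i == j).
  by move=> *; rewrite nth_uniq.
have sz0 : (0 < size s)%N by apply: leq_ltn_trans sz3.
have szn : (n < size s)%N by apply: ltn_trans sz2.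
have sz20 : (2 * n < size s)%N by apply: ltn_trans sz3; apply: ltnW.
have sz21 : ((2 * n).+1 < size s)%N by apply: ltn_trans sz3.
case: (boolP [exists i in N, 3 / 4 + d <= x i (nth 0 s 0)%N]) => [/existsP[i /andP[iN h]]|n1].
  apply: (reduce i [:: nth 0 s 0]%N) => //.
  - by move=> g; rewrite inE => /eqP ->; apply: mem_nth.
  - by rewrite big_seq1.
  by move=> j /part[f sf]; apply: reduce_first sf (u0 j).
case: (boolP [exists i in N, 3 / 4 + d <= x i (nth 0 s n)%N + x i (nth 0 s n.+1)%N]) => [/existsP[i /andP[iN h]]|n2].
  apply: (reduce i [:: nth 0 s n; nth 0 s n.+1]%N) => //.
  - by rewrite /= inE inj // ltn_eqF.
  - by move=> g; rewrite !inE => /orP[] /eqP ->; apply: mem_nth.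
  - by rewrite !big_cons big_nil addr0.
  by move=> j /part[f sf]; apply: reduce_pair sf.
case: (boolP [exists i in N, 3 / 4 + d <= x i (nth 0 s (2 * n))%N + x i (nth 0 s (2 * n).+1)%N
    + x i (nth 0 s (2 * n).+2)%N]) => [/existsP[i /andP[iN h]]|n3].
  apply: (reduce i [:: nth 0 s (2 * n); nth 0 s (2 * n).+1; nth 0 s (2 * n).+2]%N) => //.
  - by rewrite /= !inE !inj // !ltn_eqF // ltnW.
  - by move=> g; rewrite !inE => /or3P[] /eqP ->; apply: mem_nth.
  - by rewrite !big_cons big_nil addr0 addrA.
  by move=> j /part[f sf]; apply: reduce_triple sf.
have n2E : (2 * n.+1 = (2 * n).+2)%N by rewrite mulnS.
have r1 i : i \in N -> x i (nth 0 s 0)%N < 3 / 4 + d.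
  by move=> iN; rewrite ltNge; apply: contra n1 => h; apply/existsP; exists i; rewrite iN.
have r2 i : i \in N -> x i (nth 0 s n)%N + x i (nth 0 s n.+1)%N < 3 / 4 + d.
  by move=> iN; rewrite ltNge; apply: contra n2 => h; apply/existsP; exists i; rewrite iN.
have sn i j k : (j <= k)%N -> (k < size s)%N -> x i (nth 0%N s k) <= x i (nth 0%N s j).
  move=> jk ks; apply: xa; rewrite (sorted_leq_nth leq_trans leqnn 0%N) ?inE //.
    by apply: sub_sorted ss => a b; exact: ltnW.
  exact: leq_ltn_trans jk ks.
have r3 i : i \in N -> x i (nth 0 s (2 * n).+2)%N < 1 / 4 + d / 3.
  move=> iN; have h : x i (nth 0 s (2 * n))%N + x i (nth 0 s (2 * n).+1)%N + x i (nth 0 s (2 * n).+2)%N < 3 / 4 + d.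
    by rewrite ltNge; apply: contra n3 => h; apply/existsP; exists i; rewrite iN.
  have h1 := sn i (2 * n)%N (2 * n).+2 (ltnW (leqnSn _)) sz3.
  have h2 := sn i (2 * n).+1 (2 * n).+2 (leqnSn _) sz3.
  clear -h h1 h2; lra.
case: (boolP [exists i in N, 3 / 4 + d <= x i (nth 0 s 0)%N + x i (nth 0 s (2 * n).+2)%N]) => [/existsP[i /andP[iN h]]|n4].
  have n0 : nth 0%N s 0 != nth 0%N s (2 * n).+2 by rewrite inj.
  apply: (reduce i [:: nth 0 s 0; nth 0 s (2 * n).+2]%N) => //.
  - by rewrite /= inE n0.
  - by move=> g; rewrite !inE => /orP[] /eqP ->; apply: mem_nth.
  - by rewrite !big_cons big_nil addr0.
  move=> j jN; have [f sf] := part j jN.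
  (* The flat pieces of [phi] matter here: the two goods round to at most [3 / 4] and [1 / 4],
     although their values may be larger. *)
  apply: (reduce_merge us (u0 j) (mem_nth _ sz0) (mem_nth _ sz3) n0 _ sf) => /=.
  have := r1 j jN; have := r3 j jN; move: (x j (nth 0 s 0)%N) (x j (nth 0 s (2 * n).+2)%N) => q p hp hq; clear -d0 d1 hp hq.
  have : phi d p <= 1 / 4.
    by case: (phi_cases p d0 d1) => [[? ->]|[? ? ->]|[? ? ->]|[? [[-> ?]|[-> ?]]]]; lra.
  have : phi d q <= 3 / 4.
    by case: (phi_cases q d0 d1) => [[? ->]|[? ? ->]|[? ? ->]|[? [[-> ?]|[-> ?]]]]; lra.
  lra.
apply: (@final_stage_seq R T x d n N s) => //; first by rewrite n2E.
move=> i iN; rewrite n2E; split; [exact: r1 | exact: r2 | exact: r3 |].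
by rewrite ltNge; apply: contra n4 => h; apply/existsP; exists i; rewrite iN.
Qed.

(** * Reduction to ordered instances *)

(* The owner of position [k] picks a best remaining good: at most [k] goods are gone, hence one of
   the owner's [k+1] favourite goods is still available. *)
Lemma pick_in_order (R : realFieldType) (T G : finType) (g0 : G) (v : T -> G -> R) (o : nat -> T) k :
  (k <= #|G|)%N -> exists t : seq G, [/\ size t = k, uniq t & forall j, (j < k)%N ->
    v (o j) (nth g0 (sort (fun a b => v (o j) b <= v (o j) a) (enum G)) j) <= v (o j) (nth g0 t j)].
Proof.
elim: k => [|k ih] kG; first by exists [::].
have [t [st ut tP]] := ih (ltnW kG).
set s := sort (fun a b => v (o k) b <= v (o k) a) (enum G).
have ss : size s = #|G| by rewrite size_sort cardE.
have /hasP[g gs gt] : has (fun g => g \notin t) (take k.+1 s).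
  rewrite -[has _ _]negbK -all_predC; apply/negP => /allP h.
  have sub : {subset take k.+1 s <= t} by move=> g /h /=; rewrite negbK.
  have := uniq_leq_size _ sub; rewrite take_uniq ?sort_uniq ?enum_uniq //.
  by move=> /(_ isT); rewrite size_takel ?ss // st ltnn.
exists (rcons t g); split; first by rewrite size_rcons st.
  by rewrite rcons_uniq gt.
move=> j; rewrite ltnS leq_eqVlt => /orP[/eqP ->|jk].
  rewrite nth_rcons st ltnn eqxx.
  case/(nthP g0): gs => l; rewrite size_takel ?ss // => lk <-; rewrite nth_take //.
  by apply: sort_nth_le; rewrite -?cardE.
by rewrite nth_rcons st jk; apply: tP.
Qed.

(** Every agent's values are replaced by their decreasing rearrangement, followed by zeros.
    [phi_sum] turns blocks worth [1 + d] into blocks worth [1] after rounding, and [pick_in_order]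
    turns owned positions back into goods. *)
Lemma unordered_allocation (R : realFieldType) (T G : finType) (v : T -> G -> R) (d : R) :
  T -> 0 < d -> 15 * (21 * d) <= 1 -> (forall i g, 0 <= v i g) ->
  (forall i, exists f : G -> nat, forall k, (k < #|T|)%N -> 1 + d <= \sum_(g | f g == k) v i g) ->
  exists A : T -> {set G}, (forall i j, i != j -> [disjoint A i & A j]) /\
    forall i, 3 / 4 + d <= \sum_(g in A i) v i g.
Proof.
move=> t0 d0 d1 v0 part.
have [g0 _|G0] := pickP (fun _ : G => true); last first.
  have [f /(_ 0%N)] := part t0.
  have -> : (0 < #|T|)%N by apply/card_gt0P; exists t0.
  by move=> /(_ isT); rewrite big_pred0 => [|g]; [lra | have := G0 g].
pose s i := sort (fun a b => v i b <= v i a) (enum G).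
have ss i : size (s i) = #|G| by rewrite size_sort cardE.
have ps i : perm_eq (s i) (enum G) by rewrite perm_sort.
pose x i k := if (k < #|G|)%N then v i (nth g0 (s i) k) else 0.
have xa i : antitone (x i).
  move=> j k jk; rewrite /x; case: ifP => kG; last by case: ifP.
  by rewrite (leq_ltn_trans jk kG); apply: sort_nth_le; rewrite -?cardE.
have x0 i k : 0 <= x i k by rewrite /x; case: ifP.
(* The positions from [#|G|] on are worthless; they only provide the size required by
   [ordered_allocation]. *)
pose m := (#|G| + (3 * #|T| + 1))%N.
have sumx i (F : R -> R) (P : pred nat) : F 0 = 0 ->
    \sum_(k <- iota 0 m | P k) F (x i k) = \sum_(k < #|G| | P k) F (v i (nth g0 (s i) k)).
  move=> F0; rewrite /m iotaD big_cat /= [X in _ + X]big1_seq ?addr0.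
    rewrite -{1}(subn0 #|G|) -/(index_iota 0 #|G|) big_mkord; apply: eq_bigr => k _.
    by rewrite /x ltn_ord.
  move=> k /andP[_]; rewrite mem_iota add0n => /andP[Gk _].
  by rewrite /x ltnNge Gk.
have phi00 : phi d 0 = 0 by case: (phi_cases 0 d0 d1) => [[? ->]|[? ? ->]|[? ? ->]|[? _]]; lra.
have [||||o oP] := @ordered_allocation R T x d t0 d0 d1 xa x0 #|T| [set: T] (iota 0 m).
- by rewrite cardsT.
- exact: iota_ltn_sorted.
- by rewrite size_iota /m; lia.
- move=> i _; have [f fP] := part i; exists (fun k => f (nth g0 (s i) k)) => j jT.
  rewrite (sumx i (phi d) (fun k => f (nth g0 (s i) k) == j) phi00).
  have -> : \sum_(k < #|G| | f (nth g0 (s i) k) == j) phi d (v i (nth g0 (s i) k)) =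
      \sum_(g <- enum G | f g == j) phi d (v i g).
    by rewrite -(perm_big _ (ps i)) (big_nth g0) ss big_mkord.
  have h : all (fun y => 0 <= y) [seq v i g | g <- enum G & f g == j].
    by apply/allP => y /mapP[g _ ->].
  have h2 := phi_sum d0 d1 h; rewrite !big_map 2!big_filter in h2; apply: h2.
  apply: le_trans (fP j jT) _; rewrite big_enum_cond le_eqVlt; apply/orP; left; apply/eqP.
  by apply: eq_bigl => g; rewrite inE.
have [t [st ut tP]] := pick_in_order g0 v o (leqnn #|G|).
exists (fun i => [set g | (g \in t) && (o (index g t) == i)]); split.
  move=> i j ij; rewrite -setI_eq0; apply/eqP/setP => g; rewrite !inE.
  case: (g \in t) => //=; case: (eqVneq (o (index g t)) i) => //= ->.
  by rewrite (negPf ij).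
move=> i; apply: le_trans (oP i _) _; first by rewrite inE.
rewrite (sumx i id (fun k => o k == i)) //.
have -> : \sum_(g in [set g | (g \in t) && (o (index g t) == i)]) v i g =
    \sum_(g <- t | o (index g t) == i) v i g.
  rewrite -[RHS]big_filter [RHS]big_uniq ?filter_uniq //; apply: eq_bigl => g.
  by rewrite inE mem_filter andbC.
rewrite (big_nth g0) st big_mkord.
rewrite [leRHS](eq_bigl (fun k : 'I_#|G| => o k == i)); last by move=> k; rewrite index_uniq ?st.
by apply: ler_sum => k /eqP ok; have := tP k (ltn_ord k); rewrite ok.
Qed.

(** * Maximin shares and scaling *)

Lemma MMSd_witness (R : realType) (G : finType) (v : G -> R) (n : nat) (S : {set G}) :
  exists f : {ffun G -> 'I_n.+1}, forall j, MMSd v n.+1 S <= bval v [set g in S | f g == j].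
Proof.
have [f fP] : exists f : {ffun G -> 'I_n.+1}, MMSd v n.+1 S <= minbundle v S f.
  rewrite /MMSd; apply: (big_ind (fun y => exists f, y <= minbundle v S f)).
  - by exists [ffun=> ord0].
  - move=> y z [f fy] [g gz]; have [h|h] := leP y z; first by exists g.
    by exists f.
  - by move=> f _; exists f.
exists f => j; apply: le_trans fP _; rewrite /minbundle.
exact: bigmin_le_cond.
Qed.

Lemma MMSd_ge0 (R : realType) (G : finType) (v : G -> R) (n : nat) (S : {set G}) :
  (forall g, 0 <= v g) -> 0 <= MMSd v n S.
Proof.
move=> v0; case: n => [//|n]; rewrite /MMSd.
have b0 S' : 0 <= bval v S' by apply: sumr_ge0.
have m0 (f : {ffun G -> 'I_n.+1}) : 0 <= minbundle v S f.
  by rewrite /minbundle; apply: (big_ind (fun y => 0 <= y)) => // y z y0 z0; rewrite le_min y0.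
by apply: (big_ind (fun y => 0 <= y)) => // y z y0 z0; rewrite le_max y0.
Qed.

Theorem theorem46 (R : realType) (n : nat) (G : finType) (v : 'I_n -> G -> R)
  (hv : forall (i : 'I_n) (g : G), 0 <= v i g)
  (alpha : R) (halpha : alpha <= 3 / 4 + 3 / 3836) :
  exists A : 'I_n -> {set G}, is_alpha_MMS v alpha A.
Proof.
have M0 i : 0 <= MMS v i by apply: MMSd_ge0.
(* If no share is positive, in particular if there are no agents, empty bundles suffice. *)
have [j0 j0P|none] := pickP (fun i => 0 < MMS v i); last first.
  exists (fun=> set0); split; first by move=> i j _; rewrite -setI_eq0 setI0.
  move=> i; have -> : MMS v i = 0 by apply/eqP; rewrite eq_le M0 andbT leNgt none.
  by rewrite mulr0 /bval big_set0.
(* [d] solves [3 / 4 + d = (3 / 4 + e) * (1 + d)]: with shares scaled to [1 + d], a bundle worth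
   [3 / 4 + d] reaches the ratio [3 / 4 + e]. *)
pose e : R := 3 / 3836; pose d : R := e / (1 / 4 - e).
have e0 : 0 < e by rewrite /e divr_gt0 // ltr0n.
(* [1264 * e <= 1] is equivalent to [315 * e <= 1 / 4 - e], that is, to [315 * d <= 1]. *)
have e1 : 4 * (4 * (79 * e)) <= 1.
  by rewrite /e !mulrA ler_pdivrMr ?ltr0n // mul1r -!natrM ler_nat.
have q0 : 0 < 1 / 4 - e by lra.
have d0 : 0 < d by apply: divr_gt0.
have d1 : 15 * (21 * d) <= 1.
  by rewrite /d !mulrA ler_pdivrMr // mul1r; lra.
have dE : 3 / 4 + d = (3 / 4 + e) * (1 + d).
  have : d * (1 / 4 - e) = e by rewrite /d divfK // gt_eqF.
  lra.
(* agents with a zero share are given the valuation of an agent with a positive one *)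
pose c i := if 0 < MMS v i then i else j0.
have cP i : 0 < MMS v (c i) by rewrite /c; case: ifP.
pose x i g := v (c i) g * ((1 + d) / MMS v (c i)).
have k0 i : 0 < (1 + d) / MMS v (c i) by apply: divr_gt0 => //; lra.
have sumx i (P : pred G) : \sum_(g | P g) x i g = (\sum_(g | P g) v (c i) g) * ((1 + d) / MMS v (c i)).
  by rewrite mulr_suml.
have [||A [Adis AP]] := @unordered_allocation R 'I_n G x d j0 d0 d1.
- by move=> i g; apply: mulr_ge0 => //; apply: ltW.
- move=> i; case: n v hv M0 j0 j0P c cP x k0 sumx i => [|n] v hv M0 j0 j0P c cP x k0 sumx i; first by have := ltn_ord j0.
  have [f fP] := MMSd_witness (v (c i)) n [set: G].
  exists (fun g => nat_of_ord (f g)) => k; rewrite card_ord => kn.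
  rewrite sumx mulrA ler_pdivlMr // mulrC ler_wpM2r //; first by lra.
  have := fP (Ordinal kn); rewrite /bval => h; apply: le_trans h _.
  by rewrite le_eqVlt; apply/orP; left; apply/eqP; apply: eq_bigl => g; rewrite !inE.
exists A; split; first exact: Adis.
move=> i; have [ip|in0] := ltP 0 (MMS v i); last first.
  have -> : MMS v i = 0 by apply/eqP; rewrite eq_le in0 M0.
  by rewrite mulr0; apply: sumr_ge0.
have ci : c i = i by rewrite /c ip.
have := AP i; rewrite sumx ci mulrA ler_pdivlMr // dE -/(bval (v i) (A i)) => h.
have h1 : (3 / 4 + e) * MMS v i <= bval (v i) (A i).
  rewrite -(ler_pM2r (_ : 0 < 1 + d)); last by lra.
  by move: h; rewrite mulrAC.
by apply: le_trans h1; apply: ler_wpM2r.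
Qed.
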